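(* Let $1<q<\infty$ and assume the following $W^{1,q}$ well-posedness: for every $f\in W^{-1,q}(\Omega)$ the problem $-\nabla\cdot(A\nabla z)=f$ in $\Omega$, $z=0$ on $\partial\Omega$, has a unique solution $z\in W_0^{1,q}(\Omega)$, and $\|\nabla z\|_{L^q(\Omega)}\le C_{\mathrm{reg}}\|f\|_{W^{-1,q}(\Omega)}$ with $C_{\mathrm{reg}}$ independent of $f$. Then for every $\boldsymbol{\tau}\in H^q(\mathrm{div};\Omega)$ and $v\in W_0^{1,q}(\Omega)$, $$\|\boldsymbol{\tau}\|_{L^q(\Omega)}+\|v\|_{W^{1,q}(\Omega)}+\|\nabla\cdot\boldsymbol{\tau}\|_{L^q(\Omega)}\simeq\|A^{-1/2}\boldsymbol{\tau}+A^{1/2}\nabla v\|_{L^q(\Omega)}+\|\nabla\cdot\boldsymbol{\tau}\|_{L^q(\Omega)},$$ with (two-sided) constants depending only on $\alpha,\beta,q,\Omega$, and $C_{\mathrm{reg}}$.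
   Context: $\Omega\subset\mathbb R^2$ is a bounded, simply connected Lipschitz domain; $A\in L^\infty(\Omega;\mathbb R^{2\times 2})$ is symmetric and uniformly elliptic: $\alpha|\xi|^2\le\xi^TA(x)\xi\le\beta|\xi|^2$ for all $\xi\in\mathbb R^2$ and a.e. $x\in\Omega$, with $0<\alpha\le\beta$. $H^q(\mathrm{div};\Omega):=\{\boldsymbol{\tau}\in L^q(\Omega)^2:\nabla\cdot\boldsymbol{\tau}\in L^q(\Omega)\}$. With $q'=q/(q-1)$, $W^{-1,q}(\Omega)$ is the dual of $W_0^{1,q'}(\Omega)$, normed by $\|F\|_{W^{-1,q}(\Omega)}:=\sup_{0\ne\chi\in W_0^{1,q'}(\Omega)}\langle F,\chi\rangle/\|\nabla\chi\|_{L^{q'}(\Omega)}$. The equation $-\nabla\cdot(A\nabla z)=f$ means $\int_\Omega A\nabla z\cdot\nabla\chi\,dx=\langle f,\chi\rangle$ for all $\chi\in W_0^{1,q'}(\Omega)$. *)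

(* Defs.v *)
From HB Require Import structures.
From mathcomp Require Import all_boot all_order all_algebra.
From mathcomp Require Import all_classical all_reals all_analysis.

Set Implicit Arguments.
Unset Strict Implicit.
Unset Printing Implicit Defensive.

Import Order.TTheory GRing.Theory Num.Theory.
Import numFieldNormedType.Exports.

Local Open Scope classical_set_scope.
Local Open Scope ring_scope.

Section Plane.
Context {R : realType}.

Notation plane := (R * R)%type.

(* The product topology and norm of R * R are those of the max norm, so open,
   compact and bounded have their usual meaning; measurability of subsets of
   the plane and of functions is Borel measurability. *)
Notation leb2 := (@lebesgue_measure R \x @lebesgue_measure R)%E.

Definition is_path (U : set plane) (x y : plane) (c : R -> plane) : Prop :=
  [/\ {within `[0, 1], continuous c}, c 0 = x, c 1 = y
    & forall t, t \in `[0, 1] -> U (c t)].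

Definition null_homotopic (U : set plane) (x : plane) (c : R -> plane) : Prop :=
  exists H : plane -> plane,
    [/\ {within `[0, 1]%classic `*` `[0, 1]%classic, continuous H},
        forall s t, s \in `[0, 1] -> t \in `[0, 1] -> U (H (s, t)),
        forall t, t \in `[0, 1] -> H (0, t) = c t,
        forall t, t \in `[0, 1] -> H (1, t) = x
      & forall s, s \in `[0, 1] -> H (s, 0) = x /\ H (s, 1) = x].

Definition simply_connected (U : set plane) : Prop :=
  (forall x y, U x -> U y -> exists c, is_path U x y c) /\
  (forall x c, is_path U x x c -> null_homotopic U x c).

(* Coordinates of x in the orthonormal frame obtained by moving the origin to p
   and rotating the first axis onto the unit vector e. Rotations suffice: the
   reflected frames only replace gamma by its reflection below. *)
Definition frame_coord (p e x : plane) : plane :=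
  (e.1 * (x.1 - p.1) + e.2 * (x.2 - p.2),
   - e.2 * (x.1 - p.1) + e.1 * (x.2 - p.2)).

Definition lipschitz_boundary (U : set plane) : Prop :=
  forall p, (closure U `\` interior U) p ->
  exists (e : plane) (gamma : R -> R) (L r h : R),
    [/\ e.1 ^+ 2 + e.2 ^+ 2 = 1, 0 < r, 0 < h,
        forall s t, `|gamma s - gamma t| <= L * `|s - t|
      & (forall s, `|s| < r -> `|gamma s| < h) /\
        (forall x, let y := frame_coord p e x in
           `|y.1| < r -> `|y.2| < h -> U x <-> gamma y.1 < y.2)].

Definition lipschitz_domain (U : set plane) : Prop :=
  [/\ U !=set0, open U, connected U, bounded_set U & lipschitz_boundary U].

Definition enorm (xi : 'cV[R]_2) : R := Num.sqrt (\sum_i xi i 0 ^+ 2).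

Variable U : set plane.

Definition Lq (q : R) (f : plane -> R) : Prop :=
  f \_ U \in Lfun leb2 q%:E.

Definition Lq_vec (q : R) (g : plane -> 'cV[R]_2) : Prop :=
  forall i, Lq q (fun x => g x i 0).

Definition Linfty_mx (A : plane -> 'M[R]_2) : Prop :=
  forall i j, (fun x => A x i j) \_ U \in Lfun leb2 +oo%E.

Definition Lq_norm (q : R) (f : plane -> R) : \bar R :=
  Lnorm leb2 q%:E (EFin \o (f \_ U)).

Definition Lq_vec_norm (q : R) (g : plane -> 'cV[R]_2) : \bar R :=
  Lq_norm q (enorm \o g).

Definition loc_integrable (f : plane -> R) : Prop :=
  measurable_fun U f /\
  forall K, compact K -> K `<=` U -> leb2.-integrable K (EFin \o f).

Definition eq_ae (f g : plane -> R) : Prop :=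
  {ae leb2, forall x, U x -> f x = g x}.

Definition axis (i : 'I_2) : plane := if i == 0 then (1, 0) else (0, 1).

Definition partial (i : 'I_2) (phi : plane -> R) : plane -> R :=
  fun x => 'D_(axis i) phi x.

Definition smooth (phi : plane -> R) : Prop :=
  forall (s : seq 'I_2) (x : plane), differentiable (foldr partial phi s) x.

Definition test_fun (phi : plane -> R) : Prop :=
  smooth phi /\
  let supp := closure [set x | phi x != 0] in compact supp /\ supp `<=` U.

Definition grad (phi : plane -> R) : plane -> 'cV[R]_2 :=
  fun x => \col_i partial i phi x.

Definition dot (xi eta : 'cV[R]_2) : R := (xi^T *m eta) 0 0.

Definition is_weak_grad (v : plane -> R) (g : plane -> 'cV[R]_2) : Prop :=
  [/\ loc_integrable v, forall i, loc_integrable (fun x => g x i 0) &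
  forall phi, test_fun phi -> forall i,
    \int[leb2]_(x in U) (v x * partial i phi x) =
    - \int[leb2]_(x in U) (g x i 0 * phi x)].

Definition is_weak_div (tau : plane -> 'cV[R]_2) (d : plane -> R) : Prop :=
  [/\ forall i, loc_integrable (fun x => tau x i 0), loc_integrable d &
  forall phi, test_fun phi ->
    \int[leb2]_(x in U) dot (tau x) (grad phi x) =
    - \int[leb2]_(x in U) (d x * phi x)].

(* Weak derivatives are unique up to a null set; these are arbitrary
   representatives, and 0 when no weak derivative exists. *)
Definition wgrad (v : plane -> R) : plane -> 'cV[R]_2 :=
  xget (fun=> 0) [set g | is_weak_grad v g].

Definition wdiv (tau : plane -> 'cV[R]_2) : plane -> R :=
  xget (fun=> 0) [set d | is_weak_div tau d].

Definition Hdiv (q : R) (tau : plane -> 'cV[R]_2) : Prop :=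
  [/\ Lq_vec q tau, exists d, is_weak_div tau d & Lq q (wdiv tau)].

Definition W1 (q : R) (v : plane -> R) : Prop :=
  [/\ Lq q v, exists g, is_weak_grad v g & Lq_vec q (wgrad v)].

Definition W1_norm (q : R) (v : plane -> R) : \bar R :=
  ((Lq_norm q v `^ q + Lq_vec_norm q (wgrad v) `^ q) `^ q^-1)%E.

(* W_0^{1,q}, as the closure of the test functions in W^{1,q}. *)
Definition W10 (q : R) (v : plane -> R) : Prop :=
  W1 q v /\
  forall eps : R, 0 < eps ->
    exists2 phi, test_fun phi & (W1_norm q (v \- phi)%R < eps%:E)%E.

Definition conj_exp (q : R) : R := q / (q - 1).

(* W^{-1,q}: the continuous linear functionals on W_0^{1,q'}. They are given on
   functions rather than on classes of functions equal a.e.; boundedness forces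
   equal values on equal classes, and values outside W_0^{1,q'} are never used. *)
Definition Wm1 (q : R) (F : (plane -> R) -> R) : Prop :=
  (forall (a : R) chi psi, W10 (conj_exp q) chi -> W10 (conj_exp q) psi ->
     F (fun x => a * chi x + psi x) = a * F chi + F psi) /\
  exists M : R, forall chi, W10 (conj_exp q) chi ->
    (`|F chi|%:E <= M%:E * W1_norm (conj_exp q) chi)%E.

Definition Wm1_norm (q : R) (F : (plane -> R) -> R) : \bar R :=
  ereal_sup [set (F chi / fine (Lq_vec_norm (conj_exp q) (wgrad chi)))%:E
            | chi in [set chi | W10 (conj_exp q) chi /\ ~ eq_ae chi (fun=> 0)]].

Definition symmetric_ae (A : plane -> 'M[R]_2) : Prop :=
  {ae leb2, forall x, U x -> (A x)^T = A x}.

Definition elliptic (alpha beta : R) (A : plane -> 'M[R]_2) : Prop :=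
  {ae leb2, forall x, U x -> forall xi : 'cV[R]_2,
     alpha * enorm xi ^+ 2 <= dot xi (A x *m xi) <= beta * enorm xi ^+ 2}.

Definition weak_solution (q : R) (A : plane -> 'M[R]_2)
    (F : (plane -> R) -> R) (z : plane -> R) : Prop :=
  forall chi, W10 (conj_exp q) chi ->
    \int[leb2]_(x in U) dot (A x *m wgrad z x) (wgrad chi x) = F chi.

Definition W1q_well_posed (q : R) (A : plane -> 'M[R]_2) (Creg : R) : Prop :=
  forall F, Wm1 q F ->
  exists z, [/\ W10 q z /\ weak_solution q A F z,
    forall z', W10 q z' -> weak_solution q A F z' -> eq_ae z' z
    & (Lq_vec_norm q (wgrad z) <= Creg%:E * Wm1_norm q F)%E].

End Plane.

(* The symmetric positive semidefinite square root; 0 if there is none. *)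
Definition sqrtmx {R : realType} (M : 'M[R]_2) : 'M[R]_2 :=
  xget 0 [set B : 'M[R]_2 | [/\ B^T = B, forall xi, 0 <= dot xi (B *m xi)
                              & B *m B = M]].

(* Main.v *)
Require Import Defs.
From HB Require Import structures.
From mathcomp Require Import all_boot all_order all_algebra.
From mathcomp Require Import all_classical all_reals all_analysis.
From mathcomp Require Import measurable_realfun ring lra.

(** Let p = A^{-1/2} tau + A^{1/2} grad v and w = A^{1/2} p = tau + A grad v.
    Ellipticity makes |p| and |w| comparable at almost every point
    ([elliptic_flux]), and |A grad v| <= beta |grad v|. So the norm of p is
    bounded by those of tau and grad v, which is one half of the claim, and for
    the other half it suffices to bound grad v by w and div tau: then
    tau = w - A grad v is bounded as well, and v by the Poincare inequality
    ([poincare_W10]).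

    For chi in W_0^{1,q'} the definition of the divergence gives
    int A grad v . grad chi = int w . grad chi + int (div tau) chi
    ([div_duality]). Thus v is a weak solution whose right-hand side has norm
    at most |w| + C |div tau| in W^{-1,q}, by Hoelder and Poincare
    ([functional_le]). Uniqueness identifies v with the solution provided by
    well-posedness, and the a priori estimate bounds grad v
    ([well_posed_le]).

    Behind this stand three facts of analysis. Weak gradients are unique up to
    null sets, hence linear: this is the fundamental lemma of the calculus of
    variations ([fundamental_lemma]), obtained from smooth bumps converging to
    indicators of boxes. The classical gradient of a test function is its weak
    gradient ([is_weak_grad_test]), and test functions satisfy the Poincare
    inequality ([poincare_square]); both come from the fundamental theorem of
    calculus on lines, and Fubini. Hoelder and density of test functions then
    extend all identities and inequalities to W_0^{1,q}.

    Two points need care. The square root of A is meaningful only almost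
    everywhere, so the norm of p is compared with others by a monotonicity of
    the integral for arbitrary nonnegative functions ([le_integral_ae]). And
    Creg may be any real number, while the dual norm is a supremum in the
    extended reals: [well_posed_le] deals with negative Creg and with a trivial
    W_0^{1,q'}. *)

Set Implicit Arguments.
Unset Strict Implicit.
Unset Printing Implicit Defensive.

Import Order.TTheory GRing.Theory Num.Theory.
Import numFieldNormedType.Exports.

Local Open Scope classical_set_scope.
Local Open Scope ring_scope.

(** * Integrals and null sets *)
Section AeMono.
Context d (T : measurableType d) (R : realType).
Variable mu : {measure set T -> \bar R}.
Local Open Scope ereal_scope.
Import HBNNSimple.

(** For arbitrary nonnegative functions: a simple function below f, cut off on
    the exceptional null set, keeps its integral and lies below g. This compares
    norms of A^{-1/2} tau + A^{1/2} grad v, where A is controlled only outside a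
    null set. *)
Lemma le_integral_ae (f g : T -> \bar R) :
  (forall x, 0 <= f x) -> (forall x, 0 <= g x) ->
  {ae mu, forall x, f x <= g x} ->
  \int[mu]_x f x <= \int[mu]_x g x.
Proof.
move=> f0 g0 [N [mN muN fgN]].
rewrite !ge0_integralTE//; apply: ge_ereal_sup => _ [h /= hf <-].
have mCN := measurableC mN.
(* removing the null set N does not change the integral of h *)
have -> : sintegral mu h = sintegral mu (proj_nnsfun h mCN).
  transitivity (sintegral mu (h \_ setT)); first by rewrite patch_setT.
  rewrite -integral_nnsfun// -mrestrict -integral_nnsfun//.
  rewrite (ge0_negligible_integral mN)// ?setTD//.
  - exact/measurable_EFinP/measurable_funTS.
  - by move=> x _; rewrite lee_fin.
apply: ereal_sup_ubound; exists (proj_nnsfun h mCN) => //= x.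
rewrite mindicE; case: (boolP (x \in ~` N)) => [|_]; rewrite ?mulr0 ?mulr1//.
rewrite inE /= => Nx; apply: le_trans (hf x) _.
by move/subsetCl : fgN; exact.
Qed.

End AeMono.

Section AeLogic.
Context d (T : measurableType d) (R : realType).
Variable mu : {measure set T -> \bar R}.
Implicit Types P Q S : T -> Prop.

Lemma ae_imply P Q : (forall x, P x -> Q x) ->
  {ae mu, forall x, P x} -> {ae mu, forall x, Q x}.
Proof. by move=> PQ; apply: filterS. Qed.

Lemma ae_imply2 P Q S : (forall x, P x -> Q x -> S x) ->
  {ae mu, forall x, P x} -> {ae mu, forall x, Q x} -> {ae mu, forall x, S x}.
Proof. by move=> PQS; apply: filterS2. Qed.

End AeLogic.

(** * Boxes and Borel sets of the plane *)
Section Boxes.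
Context {R : realType}.
Notation plane := (R * R)%type.

Notation borel2 := (measurableTypeR R * measurableTypeR R)%type.

Definition box (p q : plane) : set plane := `]p.1, q.1[ `*` `]p.2, q.2[.
Definition cbox (p q : plane) : set plane := `[p.1, q.1] `*` `[p.2, q.2].

Lemma box_sub_cbox p q : box p q `<=` cbox p q.
Proof. by move=> x [/= ? ?]; split; apply: subset_itv_oo_cc. Qed.

Lemma compact_cbox p q : compact (cbox p q).
Proof. by apply: compact_setX; exact: segment_compact. Qed.

Lemma measurable_box p q : measurable (box p q : set borel2).
Proof. by apply: measurableX; exact: measurable_itv. Qed.

Lemma measurable_cbox p q : measurable (cbox p q : set borel2).
Proof. by apply: measurableX; exact: measurable_itv. Qed.

Lemma box_setI p q p' q' : box p q `&` box p' q' =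
  box (Num.max p.1 p'.1, Num.max p.2 p'.2) (Num.min q.1 q'.1, Num.min q.2 q'.2).
Proof.
apply/seteqP; split=> x.
  move=> [[/= + +] [/= + +]]; rewrite !in_itv /=.
  move=> /andP[? ?] /andP[? ?] /andP[? ?] /andP[? ?].
  by split; rewrite /= in_itv /= gt_max lt_min; do !(apply/andP; split).
move=> [/= + +]; rewrite !in_itv /= !gt_max !lt_min.
move=> /andP[/andP[? ?] /andP[? ?]] /andP[/andP[? ?] /andP[? ?]].
by split; split; rewrite /= in_itv /=; apply/andP.
Qed.

Definition rbox (r : (rat * rat) * (rat * rat)) : plane * plane :=
  ((ratr r.1.1, ratr r.1.2), (ratr r.2.1, ratr r.2.2)).

(** Rational corners make the boxes countably many, so that properties of open
    sets and almost-everywhere statements reduce to single boxes. *)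
Lemma rbox_nbhs (U : set plane) x : nbhs x U ->
  exists r, let B := rbox r in box B.1 B.2 x /\ cbox B.1 B.2 `<=` U.
Proof.
move=> /nbhs_ballP[e /= e0 eU]; have ltD (t : R) : t < t + e by rewrite ltrDl.
have ltB (t : R) : t - e < t by rewrite ltrBlDr ltrDl.
have [a1] := rat_in_itvoo (ltB x.1); have [a2] := rat_in_itvoo (ltB x.2).
have [b1] := rat_in_itvoo (ltD x.1); have [b2] := rat_in_itvoo (ltD x.2).
rewrite !in_itv /= => /andP[? ?] /andP[? ?] /andP[? ?] /andP[? ?].
exists ((a1, a2), (b1, b2)) => /=; split.
  by split; rewrite /= in_itv /=; apply/andP.
move=> y [] /=; rewrite !in_itv /= => /andP[? ?] /andP[? ?]; apply: eU.
by split; rewrite /= /ball /= ltr_distlC; apply/andP; split; lra.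
Qed.

Lemma open_bigcup_rbox (U : set plane) : open U ->
  U = \bigcup_(r in [set r | cbox (rbox r).1 (rbox r).2 `<=` U])
        box (rbox r).1 (rbox r).2.
Proof.
move=> oU; apply/seteqP; split=> [x Ux|x [r rU]]; last first.
  by move=> /box_sub_cbox; exact: rU.
by have [r [rx rU]] := rbox_nbhs (open_nbhs_nbhs (conj oU Ux)); exists r.
Qed.

Definition boxes : set (set plane) := [set B | exists p q, B = box p q].

Lemma open_sigma_boxes (U : set plane) : open U -> <<s boxes >> U.
Proof.
move=> /open_bigcup_rbox ->; rewrite bigcup_mkcond.
apply: (@countable_bigcupT_measurable _ (g_sigma_algebraType boxes)) => //.
move=> r; case: ifP => _; last exact: measurable0.
by apply: sub_sigma_algebra; exists (rbox r).1, (rbox r).2.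
Qed.

(** Open sets are countable unions of boxes, and the product Borel sets are
    generated by the preimages of intervals under the two projections. *)
Lemma measurable_plane_boxes : @measurable _ borel2 = <<s boxes >>.
Proof.
apply/seteqP; split; last first.
  apply: smallest_sub; first exact: sigma_algebra_measurable.
  by move=> _ [p [q ->]]; exact: measurable_box.
have mfst : measurable_fun setT (fst : g_sigma_algebraType boxes -> R).
  apply: (measurability _ (RGenOpens.measurableE R)).
  move=> _ [_ [a [b ->]] <-]; rewrite setTI; apply: open_sigma_boxes.
  by apply: open_comp => [x _|]; [exact: cvg_fst|exact: interval_open].
have msnd : measurable_fun setT (snd : g_sigma_algebraType boxes -> R).
  apply: (measurability _ (RGenOpens.measurableE R)).
  move=> _ [_ [a [b ->]] <-]; rewrite setTI; apply: open_sigma_boxes.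
  by apply: open_comp => [x _|]; [exact: cvg_snd|exact: interval_open].
rewrite measurable_prod_measurableType.
apply: smallest_sub; first exact: smallest_sigma_algebra.
move=> _ [A mA [B mB <-]].
have -> : A `*` B = (setT `&` fst @^-1` A) `&` (setT `&` snd @^-1` B).
  by rewrite !setTI.
apply: (@measurableI _ (g_sigma_algebraType boxes)).
- exact: mfst.
- exact: msnd.
Qed.

Lemma open_measurable2 (U : set plane) : open U -> measurable (U : set borel2).
Proof. by rewrite measurable_plane_boxes; exact: open_sigma_boxes. Qed.

Lemma closed_measurable2 (F : set plane) : closed F -> measurable (F : set borel2).
Proof. by move/closed_openC/open_measurable2/measurableC; rewrite setCK. Qed.

Lemma continuous_measurable_fun2 (f : plane -> R) :
  continuous f -> measurable_fun (setT : set borel2) f.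
Proof.
move=> /continuousP cf; apply: (measurability _ (RGenOpens.measurableE R)).
move=> _ [_ [a [b ->]] <-]; rewrite setTI; apply: open_measurable2.
exact/cf/interval_open.
Qed.

End Boxes.

(** * Smooth bump functions *)
Section Flat.
Context {R : realType}.
Implicit Types p : {poly R}.

Lemma expn_expRN_le n (s : R) : 0 <= s -> s ^+ n * expR (- s) <= n`!%:R.
Proof.
move=> s0; rewrite expRN ler_pdivrMr ?expR_gt0//.
case: n => [|n]; first by rewrite expr0 fact0 mul1r -[leLHS]expR0 ler_expR.
rewrite mulrC -ler_pdivrMr ?ltr0n ?fact_gt0//.
by apply: le_trans (expR_ge1Dxn n s0); rewrite lerDr.
Qed.

(** The extra power of s makes the induction on the polynomial go through: it
    absorbs the factor X of p * X + c. *)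
Lemma poly_expRN_bounded p n :
  exists C, forall s, 0 <= s -> `|p.[s]| * s ^+ n * expR (- s) <= C.
Proof.
elim/poly_ind: p n => [|p c IH] n.
  by exists 0 => s _; rewrite horner0 normr0 !mul0r.
have [C hC] := IH n.+1; exists (C + `|c| * n`!%:R) => s s0.
rewrite hornerMXaddC.
apply: (@le_trans _ _ ((`|p.[s]| * s + `|c|) * s ^+ n * expR (- s))).
  rewrite !ler_wpM2r ?expR_ge0 ?exprn_ge0// (le_trans (ler_normD _ _))//.
  by rewrite normrM (ger0_norm s0).
rewrite mulrDl mulrDl lerD//.
  by rewrite -(mulrA `|p.[s]|) -exprS hC.
by rewrite -mulrA ler_wpM2l// expn_expRN_le.
Qed.

(** The functions p(1/t) e^{-1/t}, extended by 0 to t <= 0. Allowing a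
    polynomial p, and not just e^{-1/t} itself, makes the family stable under
    differentiation, so that smoothness needs no iterated derivatives. *)
Definition flat p (t : R) : R := if 0 < t then p.[t^-1] * expR (- t^-1) else 0.

Definition flat_deriv p : {poly R} := 'X^2 * (p - p^`()).

Lemma is_derive0_quadratic (f : R -> R) C :
  f 0 = 0 -> (forall h, `|f h| <= C * h ^+ 2) -> is_derive (0 : R) 1 f 0.
Proof.
move=> f0 fC.
have C0 : 0 <= C by have := fC 1; rewrite expr1n mulr1; apply: le_trans.
suff h : (fun h => h^-1 *: ((f \o shift 0) (h *: (1 : R)) - f 0)) @ 0^' --> (0 : R).
  by apply: DeriveDef; [apply/cvg_ex; exists 0|exact: cvg_lim].
apply/cvgr0Pnorm_le => e e0.
have C1 : 0 < C + 1 by rewrite ltr_wpDl.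
near=> h.
have h0 : h != 0 by near: h; exact: nbhs_dnbhs_neq.
rewrite /= f0 subr0 addr0 normrM normfV [h%:A]mulr1.
rewrite ler_pdivrMl ?normr_gt0// (le_trans (fC h))//.
rewrite -real_normK ?num_real// expr2 mulrA mulrC ler_wpM2l//.
apply: (@le_trans _ _ ((C + 1) * `|h|)); first by rewrite ler_wpM2r// lerDl.
rewrite -ler_pdivlMl//; near: h; apply: dnbhs0_le.
by rewrite mulr_gt0// invr_gt0.
Unshelve. all: by end_near. Qed.

(** At t = 0 exponential decay beats every power of 1/t, so the function is
    bounded by a multiple of t^2 and its derivative vanishes. *)
Lemma is_derive_flat p (t : R) : is_derive t 1 (flat p) (flat (flat_deriv p) t).
Proof.
have [t0|t0|->] := ltgtP t 0.
- rewrite [X in is_derive _ _ _ X]/flat ltNge (ltW t0) /=.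
  apply: (@near_eq_is_derive _ _ _ (cst 0)).
  near=> x; rewrite /flat ltNge ifF//; apply/negbF/ltW.
  by near: x; exact: lt_nbhsl.
- rewrite [X in is_derive _ _ _ X]/flat t0.
  have dV : is_derive t 1 (fun t : R => t^-1) (- t ^- 2 *: 1).
    by apply: is_deriveV; rewrite gt_eqF.
  have dp := @is_derive1_comp _ _ _ _ _ _ (is_derive_poly p t^-1) dV.
  have dN := @is_deriveN _ _ _ _ _ _ _ dV.
  have de := @is_derive1_comp _ expR (- (@GRing.inv R)) t _ _ (is_derive_expR (- t^-1)) dN.
  have dM := @is_deriveM _ _ _ _ _ _ _ _ dp de.
  apply: is_derive_eq; first apply: near_eq_is_derive dM.
    near=> x; rewrite /flat ifT//.
    by near: x; exact: lt_nbhsr.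
  rewrite /flat_deriv !hornerE /= /GRing.scale /= !mulr1 exprVn.
  by ring.
- rewrite [X in is_derive _ _ _ X]/flat ltxx.
  have [C hC] := poly_expRN_bounded p 2.
  apply: (@is_derive0_quadratic _ `|C|); first by rewrite /flat ltxx.
  move=> h; rewrite /flat; case: ifPn => h0; last first.
    by rewrite normr0 mulr_ge0// sqr_ge0.
  rewrite -ler_pdivrMr ?exprn_gt0// normrM (ger0_norm (expR_ge0 _)).
  apply: le_trans (ler_norm C); rewrite -exprVn mulrAC; apply: hC.
  by rewrite invr_ge0 ltW.
Unshelve. all: by end_near. Qed.

End Flat.

Section FlatAlgebra.
Context {R : realType}.
Notation plane := (R * R)%type.

Definition coord (i : 'I_2) (x : plane) : R := if i == 0 then x.1 else x.2.

(** An algebra of functions of the plane closed under partial derivatives;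
    every member is therefore smooth. Affine changes of one coordinate are all
    that bumps need. *)
Inductive flat_alg : (plane -> R) -> Prop :=
| flat_gen p k c i : flat_alg (fun x => flat p (k * coord i x + c))
| flat_add f g : flat_alg f -> flat_alg g -> flat_alg (fun x => f x + g x)
| flat_mul f g : flat_alg f -> flat_alg g -> flat_alg (fun x => f x * g x).

Lemma coord_continuous i : continuous (coord i).
Proof.
by move=> x; rewrite /coord; case: (i == 0); [exact: cvg_fst|exact: cvg_snd].
Qed.

Lemma is_diff_coord i (x : plane) : is_diff x (coord i) (coord i).
Proof.
have lc : linear (coord i) by move=> a u v; rewrite /coord; case: (i == 0).
pose cM := GRing.isLinear.Build _ _ _ _ _ lc.
pose cL : {linear plane -> R} := HB.pack (coord i) cM.
apply: DiffDef.
- exact: (@linear_differentiable _ _ _ cL _ (@coord_continuous i)).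
- exact: (@diff_lin _ _ _ cL _ (@coord_continuous i)).
Qed.

Lemma is_derive_comp_diff (g : R -> R) (f : plane -> R) x v dg :
  differentiable f x -> is_derive (f x) 1 g dg ->
  differentiable (g \o f) x /\ 'D_v (g \o f) x = dg * 'D_v f x.
Proof.
move=> df [dgx dgE].
have dg' : differentiable g (f x) by exact/derivable1_diffP.
split; first exact: differentiable_comp.
rewrite (deriveE _ (differentiable_comp df dg')) diff_comp//= (deriveE _ df).
rewrite -dgE (deriveE _ dg') mulrC -[X in 'd _ _ X = _]mulr1.
exact: linearZ.
Qed.

Lemma partial_affine k c i j (x : plane) :
  differentiable (fun x => k * coord i x + c) x /\
  partial j (fun x => k * coord i x + c) x = k * (i == j)%:R.
Proof.
have dc := is_diff_coord i x.
have da : is_diff x (fun x => k * coord i x + c) (fun y => k * coord i y).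
  have -> : (fun x => k * coord i x + c) = (k *: coord i) + cst c by [].
  apply: is_diff_eq; apply/funext => y; by rewrite !fctE /= addr0.
split; first by have [] := da.
rewrite /partial deriveE; last by have [] := da.
have [_ ->] := da.
congr (_ * _); rewrite /coord /axis.
by move: i j {dc da} => [[|[|//]] ?] [[|[|//]] ?].
Qed.

Lemma flat_alg_diff f : flat_alg f ->
  (forall x, differentiable f x) /\ forall j, flat_alg (partial j f).
Proof.
elim=> {f} [p k c i|f g _ [df IHf] _ [dg IHg]|f g hf [df IHf] hg [dg IHg]].
- have da := partial_affine k c i.
  split=> [x|j].
    have [dax _] := da 0 x.
    by have [] := is_derive_comp_diff 0 dax (is_derive_flat p (k * coord i x + c)).
  have -> : partial j (fun x => flat p (k * coord i x + c)) =
     (fun x => flat ((k * (i == j)%:R) *: flat_deriv p) (k * coord i x + c)).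
    apply/funext => x; have [dax pax] := da j x.
    have [_ +] := is_derive_comp_diff (axis j) dax (is_derive_flat p (k * coord i x + c)).
    rewrite /partial in pax *; rewrite /comp => ->; rewrite pax mulrC /flat.
    by case: ifP; rewrite ?mulr0// hornerZ mulrA.
  exact: flat_gen.
- split=> [x|j]; first exact: differentiableD.
  have -> : partial j (fun x => f x + g x) = fun x => partial j f x + partial j g x.
    by apply/funext => x; rewrite /partial deriveD//; exact: diff_derivable.
  exact: flat_add.
- split=> [x|j]; first exact: differentiableM.
  have -> : partial j (fun x => f x * g x) =
      fun x => f x * partial j g x + g x * partial j f x.
    by apply/funext => x; rewrite /partial deriveM//; exact: diff_derivable.
  by apply: flat_add; apply: flat_mul.
Qed.

Lemma smooth_flat_alg f : flat_alg f -> smooth f.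
Proof.
move=> hf s; have : flat_alg (foldr partial f s).
  by elim: s => //= i s /flat_alg_diff[_]; exact.
by move=> /flat_alg_diff[].
Qed.

(** As n grows, e^{-1/(nt)} increases to 1 for each t > 0 and stays 0 for
    t <= 0; hence smooth functions supported in the closed box tend to the
    indicator of the open one. *)
Definition bump1 n (a b t : R) : R :=
  flat 1 (n.+1%:R * (t - a)) * flat 1 (n.+1%:R * (b - t)).

Definition bump n (p q : plane) (x : plane) : R :=
  bump1 n p.1 q.1 x.1 * bump1 n p.2 q.2 x.2.

Lemma flat1_ge0_le1 (t : R) : 0 <= flat 1 t <= 1.
Proof.
rewrite /flat; case: ifPn => t0; last by rewrite lexx ler01.
by rewrite hornerC mul1r expR_ge0 -[leRHS]expR0 ler_expR oppr_le0 invr_ge0 ltW.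
Qed.

Lemma bump_ge0_le1 n p q x : 0 <= bump n p q x <= 1.
Proof.
have h t u : 0 <= flat 1 t * flat 1 u <= (1 : R).
  have /andP[? ?] := flat1_ge0_le1 t; have /andP[? ?] := flat1_ge0_le1 u.
  by rewrite mulr_ge0//= mulr_ile1.
rewrite /bump /bump1.
set A := _ * flat 1 _; set B := _ * flat 1 _.
have /andP[? ?] : 0 <= A <= 1 by exact: h.
have /andP[? ?] : 0 <= B <= 1 by exact: h.
by rewrite mulr_ge0//= mulr_ile1.
Qed.

Lemma bump_out n p q x : ~ box p q x -> bump n p q x = 0.
Proof.
move=> nx; apply/eqP; apply: contra_notT nx => xn0.
have fpos t : flat 1 (n.+1%:R * t) != 0 -> 0 < t :> R.
  by rewrite /flat pmulr_rgt0 ?ltr0n//; case: ifP => //; rewrite eqxx.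
move: xn0; rewrite /bump /bump1 !mulf_eq0 !negb_or.
move=> /andP[/andP[/fpos ? /fpos ?] /andP[/fpos ? /fpos ?]].
by split; rewrite /= in_itv/= -[X in X && _]subr_gt0 -[X in _ && X]subr_gt0; apply/andP.
Qed.

Lemma bump_cvg p q x : bump n p q x @[n --> \oo] --> (\1_(box p q) x : R).
Proof.
rewrite indicE; case: (boolP (x \in _)); last first.
  rewrite notin_setE => nx; apply: cvg_near_cst; near=> n.
  by rewrite bump_out.
rewrite inE => -[/=]; rewrite !in_itv /=.
move=> /andP[+ +] /andP[+ +]; rewrite -(subr_gt0 p.1) -(subr_gt0 x.1).
rewrite -(subr_gt0 p.2) -(subr_gt0 x.2) => a1 b1 a2 b2.
have f1 (t : R) : 0 < t -> flat 1 (n.+1%:R * t) @[n --> \oo] --> (1 : R).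
  move=> t0.
  have -> : (fun n => flat 1 (n.+1%:R * t)) = (fun n => expR (- (harmonic n * t^-1))).
    apply/funext => n; rewrite /flat pmulr_rgt0 ?ltr0n// t0 hornerC mul1r.
    by rewrite /harmonic invfM.
  rewrite -expR0; apply: continuous_cvg; first exact: continuous_expR.
  rewrite -oppr0; apply: cvgN; rewrite -(mul0r t^-1).
  by apply: cvgMl; exact: cvg_harmonic.
have := cvgM (cvgM (f1 _ a1) (f1 _ b1)) (cvgM (f1 _ a2) (f1 _ b2)).
by rewrite !mulr1; exact.
Unshelve. all: by end_near. Qed.

Lemma flat_alg_bump n p q : flat_alg (bump n p q).
Proof.
have -> : bump n p q = (fun x =>
   (flat 1 (n.+1%:R * coord 0 x + (- n.+1%:R * p.1)) *
    flat 1 (- n.+1%:R * coord 0 x + (n.+1%:R * q.1))) *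
   (flat 1 (n.+1%:R * coord 1 x + (- n.+1%:R * p.2)) *
    flat 1 (- n.+1%:R * coord 1 x + (n.+1%:R * q.2)))).
  apply/funext => x; rewrite /bump /bump1 /coord /=.
  by do 2!congr (_ * _); congr flat; ring.
by apply: flat_mul; apply: flat_mul; exact: flat_gen.
Qed.

Lemma test_fun_bump (U : set plane) n p q :
  cbox p q `<=` U -> test_fun U (bump n p q).
Proof.
move=> pqU; split; first exact/smooth_flat_alg/flat_alg_bump.
have clc : closed (cbox p q).
  by apply: compact_closed; [exact: norm_hausdorff|exact: compact_cbox].
have sub : closure [set x | bump n p q x != 0] `<=` cbox p q.
  move/closure_id : clc => ->; apply: closure_subset => x /= xn0.
  by apply: box_sub_cbox; apply: contrapT => /(bump_out n) /eqP; exact/negP.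
split; last exact: subset_trans pqU.
by apply: (subclosed_compact _ (@compact_cbox _ p q)) => //; exact: closed_closure.
Qed.

End FlatAlgebra.

(** * The Poincare inequality on an interval *)
Section FTC1d.
Context {R : realType}.
Notation leb := (@lebesgue_measure R).
Variables (h h' : R -> R) (M : R).
Hypothesis M0 : 0 < M.
Hypothesis dh : forall t : R, is_derive t 1 h (h' t).
Hypothesis ch' : continuous h'.
Hypothesis h0 : forall t : R, t \notin `]-M, M[ -> h t = 0.

Lemma is_derive_continuous : continuous h.
Proof.
move=> t; apply: differentiable_continuous; apply/derivable1_diffP.
by have [] := dh t.
Qed.

Lemma integral_derive (a b : R) : a < b ->
  (\int[leb]_(t in `[a, b]) (h' t)%:E = (h b)%:E - (h a)%:E)%E.
Proof.
move=> ab; apply: continuous_FTC2 => //.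
- exact: continuous_subspaceT.
- split.
  + by move=> x _; have [] := dh x.
  + by apply: cvg_at_right_filter; exact: is_derive_continuous.
  + by apply: cvg_at_left_filter; exact: is_derive_continuous.
- by move=> x _; rewrite derive1E; have [_ ->] := dh x.
Qed.

Lemma integral_derive_cc : (\int[leb]_(t in `[(- M)%R, M]) (h' t)%:E = 0)%E.
Proof.
rewrite integral_derive ?gt0_cp// !h0 ?sube0//.
- by rewrite in_itv /= ltxx.
- by rewrite in_itv /= ltxx andbF.
Qed.

(** h vanishes at -M, so h x is the integral of h' from -M to x. *)
Lemma le_integral_derive_cc (x : R) :
  (`|h x|%:E <= \int[leb]_(t in `[(- M)%R, M]) `|h' t|%:E)%E.
Proof.
case: (boolP (x \in `]-M, M[)) => [|/h0 ->]; last first.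
  by rewrite normr0; apply: integral_ge0 => t _; rewrite lee_fin.
rewrite in_itv/= => /andP[Mx xM].
have mh' : measurable_fun setT h' by exact: continuous_measurable_fun.
have : (\int[leb]_(t in `[(- M)%R, x]) (h' t)%:E = (h x)%:E)%E.
  by rewrite integral_derive// (h0 (t := - M)) ?sube0// in_itv/= ltxx.
move=> /(congr1 abse) /= <-.
apply: le_trans (le_abse_integral _ _ _) _ => //.
  exact/measurable_EFinP/measurable_funTS.
apply: ge0_subset_integral => //.
- by apply/measurable_EFinP/measurableT_comp => //; exact: measurable_funTS.
- move=> t /=; rewrite !in_itv /= => /andP[->] /= tx.
  by rewrite (le_trans tx) ?ltW.
Qed.

End FTC1d.

Section Poincare1d.
Context {R : realType}.
Notation leb := (@lebesgue_measure R).
Local Open Scope ereal_scope.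

(** The p-th power of the Hoelder factor contributed by the indicator of the
    interval, times the length over which the resulting constant is integrated. *)
Definition poincare_itv_cst (p M : R) : \bar R :=
  ((Lnorm leb (conj_exp p)%:E (EFin \o \1_(`[(- M)%R, M]%classic))) `^ p * (2 * M)%:E)%E.

Lemma conj_exp_gt1 (q : R) : (1 < q)%R -> (1 < conj_exp q)%R.
Proof.
by move=> q1; rewrite /conj_exp ltr_pdivlMr ?subr_gt0// mul1r gtrBl.
Qed.

Lemma conj_exp_inv (q : R) : (1 < q)%R -> (q^-1 + (conj_exp q)^-1 = 1)%R.
Proof.
move=> q1; have qn0 : (q != 0)%R by rewrite gt_eqF// (lt_trans _ q1).
by rewrite /conj_exp invf_div; field.
Qed.

Lemma poincare_itv_cst_lty p M : (0 < M)%R -> (1 < p)%R ->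
  0 <= poincare_itv_cst p M < +oo.
Proof.
move=> M0 p1; rewrite /poincare_itv_cst mule_ge0 ?poweR_ge0 ?lee_fin ?mulr_ge0 ?ltW//=.
rewrite lte_mul_pinfty ?poweR_ge0 ?ltry// fin_num_poweR// ge0_fin_numE ?Lnorm_ge0//.
rewrite unlock /=; apply: poweR_lty.
have q0 : (conj_exp p != 0)%R by rewrite gt_eqF// (lt_trans _ (conj_exp_gt1 p1)).
rewrite (_ : (fun _ => _) = EFin \o \1_(`[(- M)%R, M]%classic)); last first.
  apply/funext => x /=; rewrite indicE.
  by case: (x \in _); rewrite ?normr1 ?normr0 ?powR1 ?powR0.
rewrite integral_indic// setIT.
rewrite /= lebesgue_measure_itv /=.
by case: ifP; rewrite ?ltry// -EFinB ltry.
Qed.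

(** Hoelder turns |h x| <= int |h'| into a bound by the p-norm of h' that is
    uniform in x; integrating it over the interval gives the claim. *)
Lemma poincare_itv (p M : R) (h h' : R -> R) : (0 < M)%R -> (1 < p)%R ->
  (forall t : R, is_derive t 1%R h (h' t)) -> continuous h' ->
  (forall t : R, t \notin `]-M, M[%R -> h t = 0%R) ->
  \int[leb]_t (`|h t| `^ p)%:E <=
    poincare_itv_cst p M * \int[leb]_t (`|h' t| `^ p)%:E.
Proof.
move=> M0 p1 dh ch' h0.
have p0 : (0 < p)%R by rewrite (lt_trans _ p1).
have q0 : (0 < conj_exp p)%R by rewrite (lt_trans _ (conj_exp_gt1 p1)).
set I := \int[leb]_t (`|h' t| `^ p)%:E.
have mh' : measurable_fun setT h' by exact: continuous_measurable_fun.
have I0 : 0 <= I by apply: integral_ge0 => t _; rewrite lee_fin powR_ge0.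
pose K := Lnorm leb (conj_exp p)%:E (EFin \o \1_(`[(- M)%R, M]%classic)).
have NI : Lnorm leb p%:E (EFin \o h') `^ p = I.
  by rewrite poweR_Lnorm// gt_eqF.
have hx x : (`|h x| `^ p)%:E <= K `^ p * I.
  rewrite -NI -poweRM ?Lnorm_ge0// -poweR_EFin.
  apply: gt0_ler_poweR; rewrite ?in_itv/= ?andbT ?leey ?mule_ge0 ?Lnorm_ge0//.
    exact: ltW.
    by rewrite lee_fin normr_ge0.
  apply: le_trans (le_integral_derive_cc dh ch' h0 x) _.
  have := @hoelder _ _ _ leb h' \1_(`[(- M)%R, M]%classic) p (conj_exp p) mh' _ p0 q0
    (conj_exp_inv p1).
  rewrite muleC => /(_ _)/(le_trans _); apply => //.
  rewrite Lnorm1 [leLHS]integral_mkcond; apply: ge0_le_integral => //.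
  + move=> t _; rewrite /patch; case: ifP => //.
  + apply/(measurable_restrictT _ _).1 => //.
    by apply/measurable_EFinP/measurableT_comp => //; exact: measurable_funTS.
  + apply/measurable_EFinP/measurableT_comp => //; apply: measurable_funM => //.
  + move=> t _; rewrite /patch /= indicE; case: (t \in _) => /=.
      by rewrite mulr1.
    by rewrite mulr0 normr0.
apply: (@le_trans _ _ (\int[leb]_(t in `](- M)%R, M[) (cst (K `^ p * I)) t)).
  rewrite integral_mkcond [leRHS]integral_mkcond; apply: ge0_le_integral => //.
  + by move=> t _; rewrite patch_setT lee_fin powR_ge0.
  + rewrite patch_setT; apply/measurable_EFinP.
    apply: (@measurableT_comp _ _ _ _ _ _ (fun x => x `^ p)%R) => //.
    apply: measurableT_comp => //; apply: continuous_measurable_fun.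
    exact: is_derive_continuous dh.
  + by apply/(measurable_restrictT _ _).1.
  + move=> t _; rewrite patch_setT /patch; case: ifPn => // tM.
    rewrite h0 ?normr0 ?powR0 ?gt_eqF//.
    by move: tM; rewrite notin_setE /= => /negP.
rewrite integral_cst//= lebesgue_measure_itv /= ifT; last by rewrite lte_fin gt0_cp.
by rewrite -EFinB opprK -mulr2n -mulr_natl /poincare_itv_cst muleAC.
Qed.

End Poincare1d.

(** * Integrals of partial derivatives over the plane *)
Section Plane.
Context {R : realType}.
Notation plane := (R * R)%type.
Notation leb := (@lebesgue_measure R).
Notation leb2 := (@lebesgue_measure R \x @lebesgue_measure R)%E.

Definition square (M : R) : set plane := box (- M, - M) (M, M).

Lemma leb2_cbox_lty (p q : plane) : (leb2 (cbox p q) < +oo)%E.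
Proof.
rewrite /cbox product_measure1E//=.
rewrite lte_mul_pinfty ?measure_ge0//.
- rewrite ge0_fin_numE ?measure_ge0//= lebesgue_measure_itv /=.
  by case: ifP; rewrite ?ltry// -EFinB ltry.
- rewrite /= lebesgue_measure_itv /=.
  by case: ifP; rewrite ?ltry// -EFinB ltry.
Qed.

Lemma bounded_on_compact (g : plane -> R) K : continuous g -> compact K ->
  exists2 C, 0 <= C & forall x, K x -> `|g x| <= C.
Proof.
move=> cg cK; have : compact (g @` K).
  by apply: continuous_compact => //; exact: continuous_subspaceT.
move=> /compact_bounded[N [_ hN]]; exists (`|N| + 1); first by rewrite addr_ge0.
by move=> x Kx; apply: (hN (`|N| + 1)); [rewrite ltr_pwDr// ler_norm|exists x].
Qed.

Lemma integrable_continuous_cc (g : plane -> R) p q : continuous g ->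
  (forall x, ~ cbox p q x -> g x = 0) ->
  leb2.-integrable setT (EFin \o g).
Proof.
move=> cg g0.
have -> : EFin \o g = (EFin \o g) \_ (cbox p q).
  apply/funext => x; rewrite /patch; case: ifPn => //.
  by rewrite notin_setE /= => /g0 ->.
apply/(integrable_mkcond _ _).1; first exact: measurable_cbox.
apply: measurable_bounded_integrable; [exact: measurable_cbox|exact: leb2_cbox_lty| |].
- by apply: measurable_funTS; exact: continuous_measurable_fun2.
- have [C _ hC] := bounded_on_compact cg (@compact_cbox _ p q).
  exists C; split; first exact: num_real.
  by move=> D CD x /hC gC; apply: le_trans gC (ltW CD).
Qed.

(** The point whose i-th coordinate is t and whose other coordinate is s: lines
    in both directions are treated at once. *)
Definition slice (i : 'I_2) (t s : R) : plane := if i == 0 then (t, s) else (s, t).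

Lemma is_derive_line (f : plane -> R) (x v : plane) (t : R) :
  differentiable f (t *: v + x) ->
  is_derive t (1 : R) (fun t : R => f (t *: v + x)) ('D_v f (t *: v + x)).
Proof.
move=> df.
have da : is_diff t (fun t : R => t *: v + x) (fun t => t *: v).
  have -> : (fun t : R => t *: v + x) = ( *:%R ^~ v) + cst x by [].
  by apply: is_diff_eq; apply/funext => y; rewrite !fctE /= addr0.
have [daf daE] := da.
have dc : differentiable (fun t : R => f (t *: v + x)) t.
  exact: (differentiable_comp daf df).
apply: DeriveDef; first exact/derivable1_diffP.
rewrite (deriveE _ dc) (_ : (fun t : R => _) = f \o (fun t : R => t *: v + x))//.
by rewrite diff_comp//= daE scale1r (deriveE _ df).
Qed.

Lemma sliceE i t s : slice i t s = t *: axis i + slice i 0 s.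
Proof.
rewrite /slice /axis; case: (i == 0).
  by rewrite (_ : _ + _ = (t * 1 + 0, t * 0 + s))// mulr1 mulr0 addr0 add0r.
by rewrite (_ : _ + _ = (t * 0 + s, t * 1 + 0))// mulr1 mulr0 addr0 add0r.
Qed.

Lemma is_derive_slice (f : plane -> R) i (t s : R) :
  (forall x, differentiable f x) ->
  is_derive t (1 : R) (fun t => f (slice i t s)) (partial i f (slice i t s)).
Proof.
move=> df; rewrite sliceE.
rewrite (_ : (fun _ => _) = (fun t => f (t *: axis i + slice i 0 s))).
  exact: is_derive_line.
by apply/funext => u; rewrite sliceE.
Qed.

Lemma continuous_slice (g : plane -> R) i (s : R) : continuous g ->
  continuous (fun t => g (slice i t s)).
Proof.
move=> cg t; apply: (@continuous_comp _ _ _ (fun t => slice i t s) g); last exact: cg.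
rewrite /slice; case: (i == 0); apply: (@cvg_pair _ _ _ _ (nbhs _)) => //=;
  by [exact: cvg_id|exact: cvg_cst].
Qed.

Lemma slice_square i t s M : square M (slice i t s) -> t \in `]- M, M[.
Proof. by rewrite /slice; case: (i == 0) => -[]. Qed.

Section CompactC1.
Variables (f : plane -> R) (i : 'I_2) (M : R).
Hypothesis M0 : 0 < M.
Hypothesis df : forall x, differentiable f x.
Hypothesis cf : continuous (partial i f).
Hypothesis f0 : forall x, ~ square M x -> f x = 0.
Hypothesis f'0 : forall x, ~ square M x -> partial i f x = 0.

Lemma integral_slice_partial s :
  (\int[leb]_t (partial i f (slice i t s))%:E = 0)%E.
Proof.
rewrite -[RHS](@integral_derive_cc _ (fun t => f (slice i t s))
  (fun t => partial i f (slice i t s)) M) //.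
- rewrite [RHS]integral_mkcond; apply: eq_integral => t _.
  rewrite /patch; case: ifPn => //; rewrite notin_setE /= => tM.
  rewrite f'0// => /slice_square; move/subset_itv_oo_cc.
  exact: tM.
- by move=> t; exact: is_derive_slice.
- exact: continuous_slice.
- by move=> t tM; apply: f0 => /slice_square; exact/negP.
Qed.

Lemma integrable_partial_cc : leb2.-integrable setT (EFin \o partial i f).
Proof.
apply: (@integrable_continuous_cc _ (- M, - M) (M, M)) => // x nx.
by apply: f'0 => /box_sub_cbox.
Qed.

(** Fubini, with the inner integral taken along the direction of the
    derivative, where it vanishes by the fundamental theorem of calculus. *)
Lemma integral_partial_cc : (\int[leb2]_x (partial i f x)%:E = 0)%E.
Proof.
have := integral_slice_partial; have := integrable_partial_cc; rewrite /slice.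
case: (i == 0) => hi h.
- rewrite -(integral21_prod_meas1 hi)/= /fubini_G.
  by apply: integral0_eq => y _; exact: h.
- rewrite -(integral12_prod_meas1 hi)/= /fubini_F.
  by apply: integral0_eq => y _; exact: h.
Qed.

End CompactC1.

(** The inequality on an interval, integrated over the horizontal lines. *)
Lemma poincare_square (f : plane -> R) (p M : R) : 0 < M -> 1 < p ->
  (forall x, differentiable f x) -> continuous (partial 0 f) ->
  (forall x, ~ square M x -> f x = 0) ->
  (\int[leb2]_x (`|f x| `^ p)%:E <=
    poincare_itv_cst p M * \int[leb2]_x (`|partial 0 f x| `^ p)%:E)%E.
Proof.
move=> M0 p1 df cf f0.
have cf' : continuous f by move=> x; exact: differentiable_continuous.
have mpow (g : plane -> R) : continuous g ->
    measurable_fun setT (fun x => (`|g x| `^ p)%:E).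
  move=> cg; apply/measurable_EFinP.
  apply: (@measurableT_comp _ _ _ _ _ _ (fun x => x `^ p)) => //.
  by apply: measurableT_comp => //; exact: continuous_measurable_fun2.
have pow0 (g : plane -> R) x : (0 <= (`|g x| `^ p)%:E)%E.
  by rewrite lee_fin powR_ge0.
have tonelli (g : plane -> R) : continuous g ->
    (\int[leb2]_x (`|g x| `^ p)%:E =
      \int[leb]_y \int[leb]_x (`|g (x, y)| `^ p)%:E)%E.
  move=> cg; have := fubini_tonelli2 (m1 := leb) (m2 := leb) _ (mpow _ cg) (pow0 g).
  by rewrite /fubini_G.
have mG (g : plane -> R) : continuous g ->
    measurable_fun setT (fun y => \int[leb]_x (`|g (x, y)| `^ p)%:E)%E.
  move=> cg.
  have := measurable_fun_fubini_tonelli_G (m1 := leb) _ (mpow _ cg) (pow0 g).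
  by rewrite /fubini_G.
rewrite (tonelli _ cf') (tonelli _ cf).
have /andP[K0 Koo] := poincare_itv_cst_lty M0 p1.
rewrite -ge0_integralZl//; last 2 first.
- exact: (mG _ cf).
- by move=> y _; apply: integral_ge0 => x _; exact: pow0.
apply: ge0_le_integral => //.
- by move=> y _; apply: integral_ge0 => x _; exact: pow0.
- exact: (mG _ cf').
- apply: measurable_funeM.
  exact: (mG _ cf).
move=> y _.
apply: (@poincare_itv _ p M (fun t => f (t, y)) (fun t => partial 0 f (t, y))) => //.
- by move=> t; exact: (@is_derive_slice _ 0).
- exact: (@continuous_slice _ 0).
- by move=> t tM; apply: f0 => -[+ _]; exact/negP.
Qed.

End Plane.

(** * Test functions *)
Section TestFun.
Context {R : realType}.
Notation plane := (R * R)%type.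
Notation leb2 := (@lebesgue_measure R \x @lebesgue_measure R)%E.
Variable U : set plane.
Implicit Types phi psi : plane -> R.

Lemma test_fun_diff phi x : test_fun U phi -> differentiable phi x.
Proof. by move=> [/(_ [::])]. Qed.

Lemma test_fun_continuous phi : test_fun U phi -> continuous phi.
Proof. by move=> h x; apply: differentiable_continuous; exact: test_fun_diff. Qed.

Lemma test_fun_out phi x : test_fun U phi -> ~ U x -> phi x = 0.
Proof.
move=> [_ /= [_ sU]] nU; apply/eqP; apply: contra_notT nU => phix.
by apply: sU; exact: subset_closure.
Qed.

Lemma test_fun_partial phi i : test_fun U phi -> test_fun U (partial i phi).
Proof.
move=> [smo /= [cpt sU]]; split.
  by move=> s x; have := smo (rcons s i) x; rewrite foldr_rcons.
have sub : closure [set x | partial i phi x != 0] `<=` closure [set x | phi x != 0].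
  rewrite [X in _ `<=` X](closure_id _).1; last exact: closed_closure.
  apply: closure_subset => x /= dx; apply: contrapT => nx; move/negP: dx; apply.
  have := closed_openC (@closed_closure _ [set x | phi x != 0]).
  move=> o; have {o} nb := open_nbhs_nbhs (conj o nx).
  rewrite /partial (@near_eq_derive _ _ _ _ (cst 0)) ?derive_cst//.
  near=> y; apply/eqP/negPn/negP => phiy.
  have : (~` closure [set x | phi x != 0]) y by near: y.
  by apply; exact: subset_closure.
split; last exact: subset_trans sU.
by apply: (subclosed_compact _ cpt) => //; exact: closed_closure.
Unshelve. all: by end_near. Qed.

Lemma test_fun_bounded phi : test_fun U phi ->
  exists2 C, 0 <= C & forall x, `|phi x| <= C.
Proof.
move=> tp; have [_ /= [cpt _]] := tp.
have [C C0 hC] := bounded_on_compact (test_fun_continuous tp) cpt.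
exists C => // x; have [->|nx] := eqVneq (phi x) 0; first by rewrite normr0.
by apply: hC; exact: subset_closure.
Qed.

Lemma bounded_set_square : bounded_set U -> exists2 M, 0 < M & U `<=` square M.
Proof.
move=> [N [_ hN]]; exists (`|N| + 1 + 1); first by rewrite !ltr_wpDl ?addr_ge0.
move=> x Ux; have /(hN _) : N < `|N| + 1 by rewrite ltr_pwDr// ler_norm.
move=> /(_ x Ux) /=; rewrite prod_normE /= num_ge_max => /andP[x1 x2].
have h t : `|t| <= `|N| + 1 -> t \in `](- (`|N| + 1 + 1)), (`|N| + 1 + 1)[.
  by move=> ht; rewrite in_itv /= -ltr_norml (le_lt_trans ht)// ltrDl.
by split; apply: h.
Qed.

Hypothesis bU : bounded_set U.

(** The partial derivative of the product phi * psi has zero integral. *)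
Lemma test_fun_by_parts phi psi i : measurable U -> test_fun U phi -> test_fun U psi ->
  \int[leb2]_(x in U) (phi x * partial i psi x) =
  - \int[leb2]_(x in U) (partial i phi x * psi x).
Proof.
move=> mU tp ts; have [M M0 UM] := bounded_set_square bU.
have tp' := test_fun_partial i tp; have ts' := test_fun_partial i ts.
have cM f g : test_fun U f -> test_fun U g -> continuous (fun x => f x * g x).
  by move=> tf tg x; apply: cvgM; exact: test_fun_continuous.
have iM f g : test_fun U f -> test_fun U g ->
    leb2.-integrable setT (EFin \o (fun x => f x * g x)).
  move=> tf tg; apply: (@integrable_continuous_cc _ _ (- M, - M) (M, M)).
    exact: cM.
  by move=> x nx; rewrite (test_fun_out tf) ?mul0r// => /UM/box_sub_cbox.
have UT f g : test_fun U f -> test_fun U g ->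
    \int[leb2]_(x in U) (f x * g x) = \int[leb2]_x (f x * g x).
  move=> tf tg; rewrite Rintegral_mkcond; apply: eq_Rintegral => x _.
  rewrite /patch; case: ifPn => //; rewrite notin_setE => /(test_fun_out tf) ->.
  by rewrite mul0r.
rewrite !UT//; apply/eqP; rewrite -addr_eq0 -RintegralD//; [|exact: iM..].
have pE : partial i (fun x => phi x * psi x) =
    fun x => phi x * partial i psi x + partial i phi x * psi x.
  apply/funext => x; rewrite /partial deriveM; last 2 first.
  - exact/diff_derivable/test_fun_diff.
  - exact/diff_derivable/test_fun_diff.
  by rewrite /GRing.scale /= (mulrC (psi x)).
have := @integral_partial_cc _ (fun x => phi x * psi x) i M.
rewrite pE /Rintegral => -> //.
- by move=> x; apply: differentiableM; exact: test_fun_diff.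
- by move=> x; apply: cvgD; exact: cM.
- by move=> x nx; rewrite (test_fun_out tp) ?mul0r// => /UM.
- move=> x nx; rewrite (test_fun_out tp) ?mul0r// ?(test_fun_out tp') ?mul0r ?addr0//.
  + by move/UM.
  + by move/UM.
Qed.

End TestFun.

(** * The fundamental lemma of the calculus of variations *)
Section DensityMeasure.
Context d (T : measurableType d) (R : realType) (mu : {measure set T -> \bar R}).
Variable f : T -> \bar R.
Hypothesis mf : measurable_fun setT f.
Hypothesis f0 : forall x, (0 <= f x)%E.
Local Open Scope ereal_scope.

Definition density_measure of measurable_fun setT f & (forall x, 0 <= f x) :=
  fun A => \int[mu]_(x in A) f x.

Local Notation nu := (density_measure mf f0).

Let nu0 : nu set0 = 0. Proof. exact: integral_set0. Qed.
Let nu_ge0 A : 0 <= nu A. Proof. exact: integral_ge0. Qed.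
Let nu_sigma : semi_sigma_additive nu.
Proof. exact: semi_sigma_additive_nng_induced. Qed.

HB.instance Definition _ := isMeasure.Build _ _ _ nu nu0 nu_ge0 nu_sigma.

End DensityMeasure.

Section FundamentalLemma.
Context {R : realType}.
Notation plane := (R * R)%type.
Notation leb2 := (@lebesgue_measure R \x @lebesgue_measure R)%E.
Local Open Scope ereal_scope.

Lemma square_cover (x : plane) : exists n : nat, square n%:R x.
Proof.
have [n xn] : exists n : nat, (`|x.1| + `|x.2| < n%:R)%R.
  by exists (Num.bound (`|x.1| + `|x.2|)%R); apply: archi_boundP; rewrite addr_ge0.
exists n; split; rewrite /= in_itv /= -ltr_norml (le_lt_trans _ xn)//.
  by rewrite lerDl.
by rewrite lerDr.
Qed.

Local Notation borelR := (measurableTypeR R).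

(** Boxes are closed under intersection and generate the Borel sets. *)
Lemma measure_eq_boxes (m1 m2 : {measure set (borelR * borelR) -> \bar R}) :
  (forall p q : plane, m1 (box p q) = m2 (box p q)) ->
  (forall p q : plane, m1 (box p q) < +oo) ->
  forall A, measurable A -> m1 A = m2 A.
Proof.
move=> m12 moo A mA.
apply: (@measure_unique _ R (borelR * borelR)%type boxes
  (fun n => square n%:R : set (borelR * borelR)) _ _ _ _ m1 m2) => //.
- exact: measurable_plane_boxes.
- by move=> _ _ [p [q ->]] [p' [q' ->]]; rewrite box_setI; do 2!eexists.
- by move=> n; do 2!eexists.
- by rewrite -subTset => x _; have [n nx] := square_cover x; exists n.
- by move=> _ [p [q ->]].
- by move=> k; exact: moo.
Qed.

(** The positive and negative parts of F are densities of two finite measures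
    that agree on boxes, hence on all Borel sets. *)
Lemma ae_eq0_boxes (F : plane -> \bar R) : leb2.-integrable setT F ->
  (forall p q, \int[leb2]_(x in box p q) F x = 0) ->
  ae_eq leb2 setT F (cst 0).
Proof.
move=> iF F0; have mF := measurable_int _ iF.
have mFp := measurable_funepos mF; have mFn := measurable_funeneg mF.
have Fp0 x : 0 <= F^\+ x by [].
have Fn0 x : 0 <= F^\- x by [].
have iFp := integrable_funepos measurableT iF.
have iFn := integrable_funeneg measurableT iF.
have fin A (f : plane -> \bar R) : measurable A -> leb2.-integrable setT f ->
    \int[leb2]_(x in A) f x \is a fin_num.
  by move=> mA intf; apply: integrable_fin_num => //; exact: integrableS intf.
pose m1 := [the {measure set _ -> \bar R} of density_measure leb2 mFp Fp0].
pose m2 := [the {measure set _ -> \bar R} of density_measure leb2 mFn Fn0].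
have m12 A : measurable A -> m1 A = m2 A.
  apply: (@measure_eq_boxes m1 m2).
  - move=> p q; have := F0 p q; rewrite integralE => /eqP.
    have fn := fin _ _ (@measurable_box _ p q) iFn.
    have fp := fin _ _ (@measurable_box _ p q) iFp.
    by rewrite sube_eq ?add0e ?fin_num_adde_defl// ?fin_numN// => /eqP.
  - move=> p q; rewrite /= /density_measure ltey_eq fin//; exact: measurable_box.
apply: (integral_ae_eq measurableT iF (measurable_cst _)).
move=> E _ mE; rewrite integral0 integralE.
by have := m12 E mE; rewrite /= /density_measure => ->; rewrite subee ?fin.
Qed.

Section Local.
Variables (U : set plane) (oU : open U).

Lemma integrable_mul_test (g : plane -> R) phi : loc_integrable U g ->
  test_fun U phi -> leb2.-integrable U (EFin \o (fun x => g x * phi x)%R).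
Proof.
move=> [mg ig] tphi; have [_ /= [cK KU]] := tphi.
set K := closure _ in cK KU; have [C C0 hC] := test_fun_bounded tphi.
have mU := open_measurable2 oU.
have mK : measurable K by apply: closed_measurable2; exact: closed_closure.
have : leb2.-integrable U ((EFin \o g) \_ K).
  apply/(integrable_mkcond _ _).2; first exact: mU.
  rewrite -patch_setI setIC (setIidl KU).
  by apply/(integrable_mkcond _ _).1; [exact: mK|exact: ig].
have mphi : measurable_fun U phi.
  by apply: measurable_funTS; apply: continuous_measurable_fun2; exact: test_fun_continuous tphi.
move=> /(integrableZl mU C); apply: le_integrable => //.
  by apply/measurable_EFinP; exact: measurable_funM.
move=> x Ux /=; rewrite /patch; case: ifPn => [_|].
  by rewrite -EFinM lee_fin !normrM mulrC ler_wpM2r// (le_trans (hC x)) ?ler_norm.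
rewrite notin_setE => nK; have -> : phi x = 0%R.
  by apply/eqP; apply: contra_notT nK => phix; exact: subset_closure.
by rewrite mulr0 mule0.
Qed.

(** Bumps converge boundedly to the indicator of the box, and all of them live
    in the closed box, where g is integrable: dominated convergence. *)
Lemma integral_box0 (g : plane -> R) p q : loc_integrable U g ->
  (forall phi, test_fun U phi -> (\int[leb2]_(x in U) (g x * phi x) = 0)%R) ->
  cbox p q `<=` U -> \int[leb2]_(x in box p q) (g x)%:E = 0.
Proof.
move=> lg g0 pqU; have [mg ig] := lg.
have mU := open_measurable2 oU; have mc := @measurable_cbox _ p q.
have igc := ig _ (@compact_cbox _ p q) pqU.
have mgc : measurable_fun (cbox p q) g by exact: measurable_funS mg.
have mb n : measurable_fun (cbox p q) (bump n p q).
  apply: measurable_funTS; apply: continuous_measurable_fun2.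
  exact: test_fun_continuous (test_fun_bump n pqU).
have int0 n : \int[leb2]_(x in cbox p q) (g x * bump n p q x)%:E = 0.
  have tb := test_fun_bump n pqU.
  have /(integrable_fin_num mU) := integrable_mul_test lg tb.
  have := g0 _ tb; rewrite /Rintegral.
  have -> : \int[leb2]_(x in U) ((EFin \o (fun x => g x * bump n p q x)%R) x) =
      \int[leb2]_(x in cbox p q) (g x * bump n p q x)%:E.
    rewrite integral_mkcond [RHS]integral_mkcond; apply: eq_integral => x _.
    rewrite /patch; case: ifPn => xU; case: ifPn => xc //.
    - by rewrite /= bump_out ?mulr0//; move: xc; rewrite notin_setE => + /box_sub_cbox.
    - by move: xU xc; rewrite notin_setE inE => + /pqU.
  by move=> + /fineK; move=> -> <-.
have mbox : measurable_fun (cbox p q) (\1_(box p q) : plane -> R).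
  by apply: measurable_funTS; apply: measurable_indic; exact: measurable_box.
pose fn n x := (g x * bump n p q x)%:E; pose f x := (g x * \1_(box p q) x)%:E.
have mfn n : measurable_fun (cbox p q) (fn n).
  by apply/measurable_EFinP; exact: measurable_funM.
have mf : measurable_fun (cbox p q) f.
  by apply/measurable_EFinP; exact: measurable_funM.
have cvgf : {ae leb2, forall x, cbox p q x -> fn ^~ x @ \oo --> f x}.
  apply: aeW => x _; apply: cvg_EFin; first exact: nearW.
  by apply: cvgMr; exact: bump_cvg.
have domf : {ae leb2, forall x n, cbox p q x -> `|fn n x| <= (`|g x|)%:E}.
  apply: aeW => x n _; rewrite /fn abse_EFin lee_fin normrM ler_piMr//.
  by have /andP[b0 b1] := bump_ge0_le1 n p q x; rewrite ger0_norm.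
have [_ _] := dominated_convergence mc mfn mf cvgf (integrable_abse igc) domf.
rewrite (_ : [sequence _]_n = cst 0); last by apply/funext => n; exact: int0.
move=> /(cvg_unique _ (@cvg_cst _ _ _ _ _)) => /(_ (@ereal_hausdorff _)) => E0.
transitivity (\int[leb2]_(x in cbox p q) f x); last by rewrite -E0.
rewrite integral_mkcond [RHS]integral_mkcond; apply: eq_integral => x _.
rewrite /patch /f indicE; case: (boolP (x \in box p q)) => [|_] /=.
  by rewrite inE => /box_sub_cbox xc; rewrite mem_set// mulr1.
by rewrite mulr0 if_same.
Qed.

(** The du Bois-Reymond lemma: g has zero integral on every box whose closure
    lies in U, so it vanishes almost everywhere on each of the countably many
    rational ones, and these cover U. *)
Lemma fundamental_lemma (g : plane -> R) : loc_integrable U g ->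
  (forall phi, test_fun U phi -> (\int[leb2]_(x in U) (g x * phi x) = 0)%R) ->
  eq_ae U g (fun=> 0%R).
Proof.
move=> lg g0; have [mg ig] := lg.
have loc r : cbox (rbox r).1 (rbox r).2 `<=` U ->
    {ae leb2, forall x, box (rbox r).1 (rbox r).2 x -> g x = 0%R}.
  set p := (rbox r).1; set q := (rbox r).2 => pqU.
  have mb := @measurable_box _ p q.
  have igc : leb2.-integrable (box p q) (EFin \o g).
    apply: integrableS (ig _ (@compact_cbox _ p q) pqU) => //.
      exact: measurable_cbox.
    exact: box_sub_cbox.
  have := @ae_eq0_boxes ((EFin \o g) \_ (box p q)).
  move=> /(_ ((integrable_mkcond _ mb).1 igc)).
  case=> [p' q'|N [mN N0 sN]].
    rewrite -integral_mkcondr box_setI; apply: integral_box0 => //.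
    apply: subset_trans pqU => x [] /=; rewrite !in_itv /= !ge_max !le_min.
    move=> /andP[/andP[_ ?] /andP[_ ?]] /andP[/andP[_ ?] /andP[_ ?]].
    by split; rewrite /= in_itv/=; apply/andP.
  exists N; split=> // x /= /not_implyP[bx gx]; apply: sN => /=.
  by move=> /(_ I); rewrite /patch mem_set//= => -[].
have oUE := open_bigcup_rbox oU.
have : {ae leb2, forall x, forall r, cbox (rbox r).1 (rbox r).2 `<=` U ->
    box (rbox r).1 (rbox r).2 x -> g x = 0%R}.
  have := @ae_foralln _ _ _ leb2 (fun n x => if unpickle n is Some r then
    cbox (rbox r).1 (rbox r).2 `<=` U -> box (rbox r).1 (rbox r).2 x -> g x = 0%R
    else True).
  case=> [n|N hN].
    case: (unpickle n) => [r|]; last exact: aeW.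
    have [/loc|nr] := pselect (cbox (rbox r).1 (rbox r).2 `<=` U).
      by apply: ae_imply => x h _; exact: h.
    by apply: aeW => x /nr.
  exists N; case: hN => mN N0 sN; split=> // x /= nx; apply: sN => /= h.
  by apply: nx => r; have := h (pickle r); rewrite pickleK.
apply: ae_imply => x hx Ux; move: Ux; rewrite {1}oUE => -[r /= rU rx].
exact: hx rU rx.
Qed.

End Local.
End FundamentalLemma.

(** * Euclidean vectors of the plane *)
Section Vectors.
Context {R : realType}.
Implicit Types xi eta : 'cV[R]_2.

Lemma sum_ord2 (F : 'I_2 -> R) : \sum_i F i = F 0 + F 1.
Proof. by rewrite big_ord_recl big_ord1; congr (F _ + F _); exact: val_inj. Qed.

Lemma enormE xi : enorm xi = Num.sqrt (xi 0 0 ^+ 2 + xi 1 0 ^+ 2).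
Proof. by rewrite /enorm sum_ord2. Qed.

Lemma enorm_ge0 xi : 0 <= enorm xi.
Proof. exact: sqrtr_ge0. Qed.

Lemma enorm_sq xi : enorm xi ^+ 2 = xi 0 0 ^+ 2 + xi 1 0 ^+ 2.
Proof. by rewrite enormE sqr_sqrtr// addr_ge0// sqr_ge0. Qed.

Lemma dotE xi eta : dot xi eta = xi 0 0 * eta 0 0 + xi 1 0 * eta 1 0.
Proof. by rewrite /dot mxE sum_ord2 !mxE. Qed.

Lemma dot_enorm xi : dot xi xi = enorm xi ^+ 2.
Proof. by rewrite dotE enorm_sq !expr2. Qed.

Lemma dot_le xi eta : `|dot xi eta| <= enorm xi * enorm eta.
Proof.
rewrite -ler_sqr ?nnegrE ?mulr_ge0 ?enorm_ge0// real_normK ?num_real//.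
rewrite exprMn !enorm_sq dotE; set a := xi 0 0; set b := xi 1 0.
set c := eta 0 0; set d := eta 1 0; rewrite -subr_ge0.
by rewrite (_ : _ - _ = (a * d - b * c) ^+ 2) ?sqr_ge0//; ring.
Qed.

Lemma coef_le_enorm xi i : `|xi i 0| <= enorm xi.
Proof.
rewrite -ler_sqr ?nnegrE ?enorm_ge0// real_normK ?num_real// enorm_sq.
case: (eqVneq i 0) => [->|i0]; first by rewrite lerDl sqr_ge0.
have -> : i = 1 by apply/val_inj; move: i i0 => [[|[|]]].
by rewrite lerDr sqr_ge0.
Qed.

Lemma enorm_le_sum xi : enorm xi <= `|xi 0 0| + `|xi 1 0|.
Proof.
rewrite -ler_sqr ?nnegrE ?enorm_ge0 ?addr_ge0// enorm_sq sqrrD.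
rewrite !real_normK ?num_real// [leRHS]addrAC lerDl.
by rewrite mulrn_wge0// mulr_ge0.
Qed.

Lemma enormD xi eta : enorm (xi + eta) <= enorm xi + enorm eta.
Proof.
rewrite -ler_sqr ?nnegrE ?enorm_ge0 ?addr_ge0 ?enorm_ge0//.
have := le_trans (ler_norm _) (dot_le xi eta).
rewrite sqrrD !enorm_sq dotE !mxE; set a := xi 0 0; set b := xi 1 0.
set c := eta 0 0; set d := eta 1 0; nra.
Qed.

Lemma enormZ (c : R) xi : enorm (c *: xi) = `|c| * enorm xi.
Proof.
by rewrite !enormE !mxE !exprMn -mulrDr sqrtrM ?sqr_ge0// sqrtr_sqr.
Qed.

End Vectors.

(** * Norms of functions and vector fields on a domain *)
Section LqNorm.
Context {R : realType}.
Notation plane := (R * R)%type.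
Notation leb2 := (@lebesgue_measure R \x @lebesgue_measure R)%E.
Notation borel2 := (measurableTypeR R * measurableTypeR R)%type.
Variable U : set plane.
Hypothesis mU : measurable (U : set borel2).
Implicit Types (q : R) (f g : plane -> R).
Local Open Scope ereal_scope.

Lemma Lq_norm_ge0 q f : 0 <= Lq_norm U q f.
Proof. exact: Lnorm_ge0. Qed.

Lemma Lq_vec_norm_ge0 q (g : plane -> 'cV[R]_2) : 0 <= Lq_vec_norm U q g.
Proof. exact: Lnorm_ge0. Qed.

Lemma Lq_norm_ae_le q f g : (0 < q)%R ->
  {ae leb2, forall x, U x -> (`|f x| <= `|g x|)%R} ->
  Lq_norm U q f <= Lq_norm U q g.
Proof.
move=> q0 fg; rewrite /Lq_norm unlock /=.
have q1 : (0 <= q^-1)%R by rewrite invr_ge0 ltW.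
have pos (h : plane -> \bar R) : (forall x, 0 <= h x) ->
    (\int[leb2]_x h x)%E \in `[0, +oo].
  by move=> h0; rewrite in_itv /= leey andbT; exact: integral_ge0.
have le : \int[leb2]_x (`|(f \_ U) x|%:E `^ q) <= \int[leb2]_x (`|(g \_ U) x|%:E `^ q).
  apply: le_integral_ae; [by move=> x; exact: poweR_ge0|by move=> x; exact: poweR_ge0|].
  apply: ae_imply fg => x fg; apply: gt0_ler_poweR; first exact: ltW.
  - by rewrite in_itv /= leey andbT lee_fin.
  - by rewrite in_itv /= leey andbT lee_fin.
  rewrite !patchE; case: ifPn => // xU; rewrite lee_fin; apply: fg.
  by move: xU; rewrite inE.
apply: (gt0_ler_poweR q1) le; by apply: pos => x; exact: poweR_ge0.
Qed.

Lemma Lq_norm_ae_eq q f g : (0 < q)%R -> eq_ae U f g ->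
  Lq_norm U q f = Lq_norm U q g.
Proof.
by move=> q0 fg; apply/eqP; rewrite eq_le; apply/andP; split;
  apply: Lq_norm_ae_le => //; apply: ae_imply fg => x fg Ux; rewrite fg.
Qed.

Lemma Lq_norm_abs q f : (0 < q)%R ->
  Lq_norm U q (fun x => `|f x|)%R = Lq_norm U q f.
Proof.
by move=> q0; apply/eqP; rewrite eq_le; apply/andP; split;
  apply: Lq_norm_ae_le => //; apply: aeW => x _; rewrite normr_id.
Qed.

Lemma Lq_norm0 q : (0 < q)%R -> Lq_norm U q (fun=> 0%R) = 0.
Proof.
move=> q0; rewrite /Lq_norm (_ : EFin \o _ = cst 0); last first.
  by apply/funext => x; rewrite /= patchE if_same.
by rewrite Lnorm0// eqe gt_eqF.
Qed.

Lemma restrict_measurable f :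
  measurable_fun (U : set borel2) f <-> measurable_fun (setT : set borel2) (f \_ U).
Proof. exact: measurable_restrictT. Qed.

Lemma LqP q f : Lq U q f <->
  measurable_fun (U : set borel2) f /\ Lq_norm U q f < +oo.
Proof.
rewrite /Lq; split.
- move=> fL; split.
  + by apply/restrict_measurable; exact: (set_mem (sub_Lfun_mfun fL)).
  + exact: (set_mem (sub_Lfun_finLfun fL)).
- move=> [/restrict_measurable mf foo]; apply/andP; split.
  + exact/mem_set.
  + exact/mem_set.
Qed.

Lemma Lq_normD q f g : (1 <= q)%R ->
  measurable_fun (U : set borel2) f -> measurable_fun (U : set borel2) g ->
  Lq_norm U q (fun x => f x + g x)%R <= Lq_norm U q f + Lq_norm U q g.
Proof.
move=> q1 /restrict_measurable mf /restrict_measurable mg; rewrite /Lq_norm.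
have -> : (fun x => f x + g x)%R \_ U = ((f \_ U) \+ (g \_ U))%R.
  by apply/funext => x; rewrite /= !patchE; case: ifP; rewrite ?addr0.
exact: minkowski.
Qed.

Lemma Lq_norm_le_sum q f f1 f2 : (1 <= q)%R ->
  measurable_fun (U : set borel2) f1 -> measurable_fun (U : set borel2) f2 ->
  {ae leb2, forall x, U x -> (`|f x| <= `|f1 x| + `|f2 x|)%R} ->
  Lq_norm U q f <= Lq_norm U q f1 + Lq_norm U q f2.
Proof.
move=> q1 m1 m2 le; have q0 : (0 < q)%R by rewrite (lt_le_trans _ q1).
rewrite -(Lq_norm_abs f1 q0) -(Lq_norm_abs f2 q0).
have m1' : measurable_fun (U : set borel2) (fun x => `|f1 x|)%R by exact: measurableT_comp.
have m2' : measurable_fun (U : set borel2) (fun x => `|f2 x|)%R by exact: measurableT_comp.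
apply: le_trans (Lq_normD q1 m1' m2'); apply: Lq_norm_ae_le => //.
by apply: ae_imply le => x le Ux; rewrite [leRHS]ger0_norm ?addr_ge0// le.
Qed.

Lemma Lq_normZ q (c : R) f : (0 < q)%R -> measurable_fun (U : set borel2) f ->
  Lq_norm U q (fun x => c * f x)%R = `|c|%:E * Lq_norm U q f.
Proof.
move=> q0 /restrict_measurable mf; rewrite /Lq_norm unlock /=.
have -> : \int[leb2]_x (`|((fun x => c * f x)%R \_ U) x|%:E `^ q) =
    (`|c| `^ q)%:E * \int[leb2]_x (`|(f \_ U) x|%:E `^ q).
  have mp : measurable_fun (setT : set borel2) (fun x => `|(f \_ U) x|%:E `^ q).
    rewrite (_ : (fun x => _) = EFin \o (fun x => `|(f \_ U) x| `^ q)%R)//.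
    apply/measurable_EFinP.
    apply: (@measurableT_comp _ _ _ _ _ _ (fun x => x `^ q)%R) => //.
    exact: measurableT_comp.
  rewrite -(ge0_integralZl _ measurableT mp)//; last by move=> x _; exact: poweR_ge0.
  apply: eq_integral => x _; rewrite !patchE; case: ifP => _; last first.
    by rewrite normr0 poweR_EFin powR0 ?mule0// gt_eqF.
  by rewrite normrM EFinM poweRM ?lee_fin// poweR_EFin.
rewrite poweRM ?lee_fin ?powR_ge0//; last first.
  by apply: integral_ge0 => x _; exact: poweR_ge0.
by rewrite poweR_EFin -powRrM mulfV ?gt_eqF// powRr1.
Qed.

Lemma LqD q f g : (1 <= q)%R -> Lq U q f -> Lq U q g -> Lq U q (fun x => f x + g x)%R.
Proof.
move=> q1 /LqP[mf foo] /LqP[mg goo]; apply/LqP; split.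
  exact: measurable_funD.
by apply: le_lt_trans (Lq_normD q1 mf mg) _; rewrite lte_add_pinfty.
Qed.

Lemma LqZ q (c : R) f : (0 < q)%R -> Lq U q f -> Lq U q (fun x => c * f x)%R.
Proof.
move=> q0 /LqP[mf foo]; apply/LqP; split; first exact: measurable_funM.
by rewrite Lq_normZ// lte_mul_pinfty.
Qed.

Lemma Lq_ae_le q f g : (0 < q)%R -> measurable_fun (U : set borel2) f ->
  {ae leb2, forall x, U x -> (`|f x| <= `|g x|)%R} -> Lq_norm U q g < +oo ->
  Lq U q f.
Proof.
move=> q0 mf fg goo; apply/LqP; split => //.
exact: le_lt_trans (Lq_norm_ae_le q0 fg) goo.
Qed.

Lemma Lq_hoelder_abs q f g : (1 < q)%R ->
  measurable_fun (U : set borel2) f -> measurable_fun (U : set borel2) g ->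
  \int[leb2]_(x in U) `|f x * g x|%:E <= Lq_norm U q f * Lq_norm U (conj_exp q) g.
Proof.
move=> q1 /restrict_measurable mf /restrict_measurable mg.
apply: le_trans (hoelder _ mf mg _ _ (conj_exp_inv q1)).
- rewrite Lnorm1 [leLHS]integral_mkcond; apply: ge0_le_integral => //.
  + by move=> x _; rewrite patchE; case: ifP.
  + rewrite (_ : _ \_ U = (fun x => `|(f \_ U) x * (g \_ U) x|%:E)).
      by apply/measurable_EFinP; apply: measurableT_comp => //; exact: measurable_funM.
    by apply/funext => x; rewrite !patchE; case: ifP => _; rewrite ?mulr0 ?normr0.
  + by apply/measurable_EFinP; apply: measurableT_comp => //; exact: measurable_funM.
  + by move=> x _; rewrite /= !patchE; case: ifP => _; rewrite ?mulr0 ?normr0.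
- by rewrite (lt_trans _ q1).
- by rewrite (lt_trans _ (conj_exp_gt1 q1)).
Qed.

(** Stated for any h dominated by f * g so as to cover both products of
    functions and dot products of vector fields. *)
Lemma Lq_hoelder_integrable q f g (h : plane -> R) : (1 < q)%R -> Lq U q f -> Lq U (conj_exp q) g ->
  measurable_fun (U : set borel2) h ->
  {ae leb2, forall x, U x -> (`|h x| <= `|f x| * `|g x|)%R} ->
  leb2.-integrable U (EFin \o h) /\
  `|(\int[leb2]_(x in U) h x)%R|%:E <= Lq_norm U q f * Lq_norm U (conj_exp q) g.
Proof.
move=> q1 /LqP[mf foo] /LqP[mg goo] mh hfg.
have le : \int[leb2]_(x in U) `|h x|%:E <= Lq_norm U q f * Lq_norm U (conj_exp q) g.
  apply: le_trans (Lq_hoelder_abs q1 mf mg).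
  apply: ae_ge0_le_integral => //.
  - by apply/measurable_EFinP; apply: measurableT_comp.
  - by apply/measurable_EFinP; apply: measurableT_comp => //; exact: measurable_funM.
  - by apply: ae_imply hfg => x hfg Ux; rewrite lee_fin normrM hfg.
have ih : leb2.-integrable U (EFin \o h).
  apply/integrableP; split; first exact/measurable_EFinP.
  apply: le_lt_trans le _; rewrite lte_mul_pinfty ?Lq_norm_ge0//.
  by rewrite ge0_fin_numE// Lq_norm_ge0.
split=> //; apply: le_trans le.
rewrite EFin_normr_Rintegral//; apply: le_abse_integral => //.
exact/measurable_EFinP.
Qed.

Lemma measurable_enorm (g : plane -> 'cV[R]_2) :
  (forall i, measurable_fun (U : set borel2) (fun x => g x i 0%R)) ->
  measurable_fun (U : set borel2) (enorm \o g).
Proof.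
move=> mg; rewrite (_ : enorm \o g =
  (Num.sqrt \o (fun x => g x 0 0 ^+ 2 + g x 1 0 ^+ 2))%R); last first.
  by apply/funext => x; rewrite /= enormE.
apply: measurableT_comp; first exact: continuous_measurable_fun (@sqrt_continuous R).
by apply: measurable_funD; exact: measurable_funX.
Qed.

Lemma Lq_vec_enorm q (g : plane -> 'cV[R]_2) : (1 <= q)%R ->
  Lq_vec U q g <->
  (forall i, measurable_fun (U : set borel2) (fun x => g x i 0%R)) /\
  Lq_vec_norm U q g < +oo.
Proof.
move=> q1; have q0 : (0 < q)%R by rewrite (lt_le_trans _ q1).
split=> [gL|[mg goo] i].
- have mg i : measurable_fun (U : set borel2) (fun x => g x i 0%R).
    by have /LqP[] := gL i.
  split => //.
  have m0 : measurable_fun (U : set borel2) (fun x => `|g x 0 0|)%R by exact: measurableT_comp.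
  have m1 : measurable_fun (U : set borel2) (fun x => `|g x 1 0|)%R by exact: measurableT_comp.
  apply: (@le_lt_trans _ _ (Lq_norm U q (fun x => `|g x 0 0| + `|g x 1 0|)%R)).
    apply: Lq_norm_ae_le => //; apply: aeW => x _ /=.
    by rewrite ger0_norm ?enorm_ge0// ger0_norm ?addr_ge0// enorm_le_sum.
  apply: le_lt_trans (Lq_normD q1 m0 m1) _; rewrite !Lq_norm_abs// lte_add_pinfty//.
    by have /LqP[] := gL 0%R.
  by have /LqP[] := gL 1%R.
- apply: (@Lq_ae_le _ _ (enorm \o g)) => //.
  apply: aeW => x _ /=; rewrite (ger0_norm (enorm_ge0 _)).
  exact: coef_le_enorm.
Qed.

End LqNorm.

(** * Weak gradients *)
Section WeakGrad.
Context {R : realType}.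
Notation plane := (R * R)%type.
Notation leb2 := (@lebesgue_measure R \x @lebesgue_measure R)%E.
Notation borel2 := (measurableTypeR R * measurableTypeR R)%type.
Variable U : set plane.
Hypothesis oU : open U.
Let mU : measurable (U : set borel2) := open_measurable2 oU.
Implicit Types (f v w phi : plane -> R) (g h : plane -> 'cV[R]_2).

Lemma eq_ae_Rintegral f f' :
  measurable_fun (U : set borel2) f -> measurable_fun (U : set borel2) f' ->
  eq_ae U f f' -> \int[leb2]_(x in U) f x = \int[leb2]_(x in U) f' x.
Proof.
move=> mf mg fg; rewrite /Rintegral; congr fine; apply: ae_eq_integral => //.
- exact/measurable_EFinP.
- exact/measurable_EFinP.
- by apply: ae_imply fg => x fg Ux; rewrite fg.
Qed.

Lemma Rintegral_lin (a : R) (f g : plane -> R) :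
  leb2.-integrable U (EFin \o f) -> leb2.-integrable U (EFin \o g) ->
  \int[leb2]_(x in U) (a * f x + g x) =
    a * \int[leb2]_(x in U) f x + \int[leb2]_(x in U) g x.
Proof.
move=> intf intg; rewrite RintegralD//; first by rewrite RintegralZl.
exact: (integrableZl mU a intf).
Qed.

Lemma loc_integrable_lin (a : R) (f g : plane -> R) : loc_integrable U f -> loc_integrable U g ->
  loc_integrable U (fun x => a * f x + g x).
Proof.
move=> [mf intf] [mg intg]; split.
  by apply: measurable_funD => //; exact: measurable_funM.
move=> K cK KU.
have mK : measurable (K : set borel2).
  by apply: closed_measurable2; apply: compact_closed => //; exact: norm_hausdorff.
apply: (@integrableD _ _ _ leb2 K mK (fun x => a%:E * (f x)%:E)%E (EFin \o g)).
- exact: (integrableZl mK a (intf K cK KU)).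
- exact: intg.
Qed.

Lemma test_loc_integrable phi : test_fun U phi -> loc_integrable U phi.
Proof.
move=> tphi; have cphi := test_fun_continuous tphi.
have mphi := continuous_measurable_fun2 cphi.
split; first exact: measurable_funTS.
move=> K cK KU.
have clK : closed K by apply: compact_closed => //; exact: norm_hausdorff.
have [M M0 KM] : exists2 M, 0 < M & K `<=` square M.
  exact/bounded_set_square/compact_bounded.
apply: measurable_bounded_integrable.
- exact: closed_measurable2.
- apply: le_lt_trans (leb2_cbox_lty (- M, - M) (M, M)).
  apply: le_measure; rewrite ?inE.
  + exact: closed_measurable2.
  + exact: measurable_cbox.
  + by move=> x /KM /box_sub_cbox.
- exact: measurable_funTS.
- have [C _ hC] := test_fun_bounded tphi.
  exists C; split; first exact: num_real.
  by move=> D CD x _; apply: le_trans (hC x) (ltW CD).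
Qed.

Lemma is_weak_grad_lin (a : R) v w g h : is_weak_grad U v g -> is_weak_grad U w h ->
  is_weak_grad U (fun x => a * v x + w x) (fun x => a *: g x + h x).
Proof.
move=> [lv lg vg] [lw lh wh]; split.
- exact: loc_integrable_lin.
- move=> i; rewrite (_ : (fun x => _) = fun x => a * g x i 0 + h x i 0).
    exact: loc_integrable_lin.
  by apply/funext => x; rewrite !mxE.
move=> phi tphi i; have tphi' := test_fun_partial i tphi.
rewrite (_ : (fun x => _ * partial i phi x) =
  fun x => a * (v x * partial i phi x) + w x * partial i phi x); last first.
  by apply/funext => x; rewrite mulrDl mulrA.
rewrite Rintegral_lin; [|exact: integrable_mul_test..].
rewrite [X in - X](_ : _ =
  \int[leb2]_(x in U) (a * (g x i 0 * phi x) + h x i 0 * phi x)); last first.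
  by apply: eq_Rintegral => x _; rewrite !mxE mulrDl mulrA.
rewrite Rintegral_lin; [|exact: integrable_mul_test..].
by rewrite vg// wh// opprD mulrN.
Qed.

(** The components of g - h are orthogonal to all test functions. *)
Lemma is_weak_grad_unique v w g h : eq_ae U v w ->
  is_weak_grad U v g -> is_weak_grad U w h ->
  {ae leb2, forall x, U x -> g x = h x}.
Proof.
move=> vw [lv lg vg] [lw lh wh].
have gh i : {ae leb2, forall x, U x -> g x i 0 = h x i 0}.
  have := fundamental_lemma oU (loc_integrable_lin (-1) (lg i) (lh i)).
  case=> [phi tphi|N hN].
    rewrite (_ : (fun x => _ * phi x) =
      fun x => -1 * (g x i 0 * phi x) + h x i 0 * phi x); last first.
      by apply/funext => x; rewrite mulrDl mulrA.
    rewrite Rintegral_lin; [|exact: integrable_mul_test..].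
    have := vg phi tphi i; have := wh phi tphi i.
    have tphi' := test_fun_partial i tphi.
    rewrite (_ : \int[leb2]_(x in U) (w x * _) = \int[leb2]_(x in U) (v x * partial i phi x)).
      by move=> -> /oppr_inj ->; rewrite mulN1r addNr.
    apply: eq_ae_Rintegral.
    - apply: measurable_funM; first by case: lw.
      apply: measurable_funTS; apply: continuous_measurable_fun2.
      exact: test_fun_continuous tphi'.
    - apply: measurable_funM; first by case: lv.
      apply: measurable_funTS; apply: continuous_measurable_fun2.
      exact: test_fun_continuous tphi'.
    - by apply: ae_imply vw => x vw Ux; rewrite vw.
  have : {ae leb2, forall x, U x -> -1 * g x i 0 + h x i 0 = 0} by exists N.
  by apply: ae_imply => x gh Ux; have /eqP := gh Ux; rewrite mulN1r addrC subr_eq0 => /eqP ->.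
apply: ae_imply2 (gh 0) (gh 1) => x g0 g1 Ux; apply/colP => i.
case: (eqVneq i 0) => [->|i0]; first exact: g0.
have -> : i = 1 by apply/val_inj; move: i i0 => [[|[|]]].
exact: g1.
Qed.

Lemma eq_ae_refl f : eq_ae U f f.
Proof. exact: aeW. Qed.

Lemma is_weak_grad_wgrad v : (exists g, is_weak_grad U v g) -> is_weak_grad U v (wgrad U v).
Proof.
move=> [g vg].
exact: (@xgetPex _ (fun=> 0) [set g | is_weak_grad U v g] (ex_intro _ g vg)).
Qed.

(** [wgrad] is an arbitrary choice among the weak gradients; this pins it down
    up to a null set, and is how it is computed everywhere below. *)
Lemma wgrad_ae v g : is_weak_grad U v g ->
  {ae leb2, forall x, U x -> wgrad U v x = g x}.
Proof.
move=> vg; apply: (@is_weak_grad_unique v v) => //; first exact: eq_ae_refl.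
by apply: is_weak_grad_wgrad; exists g.
Qed.

Lemma wgrad_congr v w : (exists g, is_weak_grad U v g) -> (exists g, is_weak_grad U w g) ->
  eq_ae U v w -> {ae leb2, forall x, U x -> wgrad U v x = wgrad U w x}.
Proof.
by move=> /is_weak_grad_wgrad hv /is_weak_grad_wgrad hw vw; exact: is_weak_grad_unique vw hv hw.
Qed.

Hypothesis bU : bounded_set U.

(** Integration by parts between two test functions. *)
Lemma is_weak_grad_test phi : test_fun U phi -> is_weak_grad U phi (grad phi).
Proof.
move=> tphi; split; first exact: test_loc_integrable.
- move=> i; rewrite (_ : (fun x => _) = partial i phi).
    by apply: test_loc_integrable; exact: test_fun_partial.
  by apply/funext => x; rewrite mxE.
- move=> psi tpsi i; rewrite test_fun_by_parts//; congr (- _).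
  by apply: eq_Rintegral => x _; rewrite mxE.
Qed.

End WeakGrad.

(** * The space W_0^{1,q} *)
Section EPower.
Context {R : realType}.
Implicit Types (x y : \bar R) (q : R).
Local Open Scope ereal_scope.

Lemma poweRK q x : (0 < q)%R -> 0 <= x -> (x `^ q) `^ q^-1 = x.
Proof. by move=> q0 x0; rewrite -poweRrM mulfV ?gt_eqF// poweRe1. Qed.

Lemma ge0_le_poweR q x y : (0 < q)%R -> 0 <= x -> x <= y -> x `^ q <= y `^ q.
Proof.
move=> q0 x0 xy; apply: gt0_ler_poweR => //; first exact: ltW.
- by rewrite in_itv /= leey andbT.
- by rewrite in_itv /= leey andbT (le_trans x0).
Qed.

Lemma le_pnorm2 q x y : (0 < q)%R -> 0 <= x -> 0 <= y ->
  x <= (x `^ q + y `^ q) `^ q^-1.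
Proof.
move=> q0 x0 y0; rewrite -[leLHS](poweRK q0 x0); apply: ge0_le_poweR.
- by rewrite invr_gt0.
- exact: poweR_ge0.
- by rewrite leeDl// poweR_ge0.
Qed.

Lemma pnorm2_le q x y : (1 <= q)%R -> 0 <= x -> 0 <= y ->
  (x `^ q + y `^ q) `^ q^-1 <= 2%:E * (x + y).
Proof.
move=> q1 x0 y0; have q0 : (0 < q)%R by rewrite (lt_le_trans _ q1).
have xy0 : 0 <= x + y by rewrite adde_ge0.
rewrite -[leRHS](poweRK q0) ?mule_ge0//; apply: ge0_le_poweR.
- by rewrite invr_gt0.
- by rewrite adde_ge0// poweR_ge0.
rewrite poweRM// (@le_trans _ _ (2%:E * (x + y) `^ q))//.
  rewrite (_ : 2%:E = (1 + 1)%:E)// EFinD ge0_muleDl// !mul1e.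
  by apply: leeD; apply: ge0_le_poweR => //; rewrite ?leeDl ?leeDr.
rewrite lee_wpmul2r ?poweR_ge0// poweR_EFin lee_fin.
by rewrite -[leLHS]powRr1// ler_powR// ler1n.
Qed.

End EPower.

Section W10.
Context {R : realType}.
Notation plane := (R * R)%type.
Notation leb2 := (@lebesgue_measure R \x @lebesgue_measure R)%E.
Notation borel2 := (measurableTypeR R * measurableTypeR R)%type.
Variable U : set plane.
Hypotheses (oU : open U) (bU : bounded_set U).
Let mU : measurable (U : set borel2) := open_measurable2 oU.
Implicit Types (f v w phi chi : plane -> R) (g h : plane -> 'cV[R]_2) (p q : R).
Local Open Scope ereal_scope.

Lemma Lq_norm_le_W1_norm q v : (0 < q)%R -> Lq_norm U q v <= W1_norm U q v.
Proof. by move=> q0; apply: le_pnorm2; rewrite ?Lq_norm_ge0 ?Lq_vec_norm_ge0. Qed.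

Lemma Lq_wgrad_le_W1_norm q v : (0 < q)%R ->
  Lq_vec_norm U q (wgrad U v) <= W1_norm U q v.
Proof.
move=> q0; rewrite /W1_norm addeC.
by apply: le_pnorm2; rewrite ?Lq_norm_ge0 ?Lq_vec_norm_ge0.
Qed.

Lemma W1_norm_le q v : (1 <= q)%R ->
  W1_norm U q v <= 2%:E * (Lq_norm U q v + Lq_vec_norm U q (wgrad U v)).
Proof. by move=> q1; apply: pnorm2_le; rewrite ?Lq_norm_ge0 ?Lq_vec_norm_ge0. Qed.

Lemma test_fun_measurable phi : test_fun U phi -> measurable_fun (U : set borel2) phi.
Proof.
move=> tphi; apply: measurable_funTS; apply: continuous_measurable_fun2.
exact: test_fun_continuous tphi.
Qed.

Lemma grad_measurable phi i : test_fun U phi ->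
  measurable_fun (U : set borel2) (fun x => grad phi x i 0%R).
Proof.
move=> tphi; rewrite (_ : (fun x => _) = partial i phi).
  by apply: test_fun_measurable; exact: test_fun_partial.
by apply/funext => x; rewrite mxE.
Qed.

Lemma W1_measurable q v : W1 U q v -> measurable_fun (U : set borel2) v.
Proof. by move=> [/(LqP mU)[]]. Qed.

Lemma W1_wgrad_measurable q v i : W1 U q v ->
  measurable_fun (U : set borel2) (fun x => wgrad U v x i 0%R).
Proof. by move=> [_ _ /(_ i)/(LqP mU)[]]. Qed.

Lemma W1_Lq_lty q v : W1 U q v -> Lq_norm U q v < +oo.
Proof. by move=> [/(LqP mU)[]]. Qed.

Lemma W1_wgrad_lty q v : (1 <= q)%R -> W1 U q v -> Lq_vec_norm U q (wgrad U v) < +oo.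
Proof. by move=> q1 [_ _ /(Lq_vec_enorm mU _ q1)[]]. Qed.

Lemma Lq_vec_measurable q g i : Lq_vec U q g ->
  measurable_fun (U : set borel2) (fun x => g x i 0%R).
Proof. by move=> /(_ i)/(LqP mU)[]. Qed.

Lemma test_fun_Lq q phi : (0 < q)%R -> test_fun U phi -> Lq U q phi.
Proof.
move=> q0 tphi; have [C C0 hC] := test_fun_bounded tphi.
have Uoo : leb2 U < +oo.
  have [M M0 UM] := bounded_set_square bU.
  apply: le_lt_trans (leb2_cbox_lty (- M, - M)%R (M, M)).
  apply: le_measure; rewrite ?inE //; first exact: measurable_cbox.
  by move=> x /UM /box_sub_cbox.
apply: (@Lq_ae_le _ _ mU _ _ (fun=> C)) => //.
- exact: test_fun_measurable.
- by apply: aeW => x _; rewrite (le_trans (hC x))// ler_norm.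
rewrite /Lq_norm unlock /=; apply: poweR_lty.
rewrite (_ : (fun x => _) = (cst (`|C| `^ q)%:E) \_ U).
  rewrite -integral_mkcond integral_cst// lte_mul_pinfty// lee_fin powR_ge0//.
apply/funext => x; rewrite !patchE; case: ifP => _ //.
by rewrite normr0 ?poweR_EFin powR0// gt_eqF.
Qed.

Lemma test_fun_Lq_grad q phi : (0 < q)%R -> test_fun U phi -> Lq_vec U q (grad phi).
Proof.
move=> q0 tphi i; rewrite (_ : (fun x => _) = partial i phi).
  by apply: test_fun_Lq => //; exact: test_fun_partial.
by apply/funext => x; rewrite mxE.
Qed.

Lemma Lq_vecB q g h : (1 <= q)%R -> Lq_vec U q g -> Lq_vec U q h ->
  Lq_vec U q (fun x => g x - h x)%R.
Proof.
move=> q1 Lg Lh i; have q0 : (0 < q)%R by rewrite (lt_le_trans _ q1).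
have := LqD mU q1 (LqZ mU (-1) q0 (Lh i)) (Lg i).
by congr (Lq _ _ _); apply/funext => x; rewrite !mxE mulN1r addrC.
Qed.

(** The weak gradient of chi - phi is the difference of the weak gradient of
    chi and the classical gradient of phi, so closeness in W^{1,p} is closeness
    of values and of these gradients. *)
Lemma W10_approx p chi (eps : R) : (1 <= p)%R -> W10 U p chi -> (0 < eps)%R ->
  exists phi, [/\ test_fun U phi, Lq_norm U p (fun x => phi x - chi x)%R < eps%:E
    & Lq_vec_norm U p (fun x => grad phi x - wgrad U chi x)%R < eps%:E].
Proof.
move=> p1 [w1 /(_ eps)] /[apply] -[phi tphi lteps]; exists phi.
have p0 : (0 < p)%R by rewrite (lt_le_trans _ p1).
split => //.
- apply: le_lt_trans lteps; apply: le_trans (Lq_norm_le_W1_norm _ p0).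
  by apply: Lq_norm_ae_le => //; apply: aeW => x _ /=; rewrite distrC.
- apply: le_lt_trans lteps; apply: le_trans (Lq_wgrad_le_W1_norm _ p0).
  have wchi : is_weak_grad U chi (wgrad U chi).
    by apply: is_weak_grad_wgrad; case: w1.
  have := is_weak_grad_lin oU (-1) (is_weak_grad_test oU bU tphi) wchi.
  rewrite (_ : (fun x => _ * phi x + _)%R = (chi \- phi)%R); last first.
    by apply/funext => x; rewrite mulN1r addrC.
  move=> /(wgrad_ae oU) wE.
  apply: Lq_norm_ae_le => //; apply: ae_imply wE => x wE Ux /=; rewrite wE//.
  rewrite -[in leLHS]opprB -scaleN1r enormZ normrN1 mul1r.
  by rewrite scaleN1r addrC.
Qed.

(** A bounded domain lies in a square, and a test function extended by 0 is
    covered by the inequality on that square. *)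
Lemma poincare_test p : (1 < p)%R -> exists2 C : R, (0 <= C)%R &
  forall phi, test_fun U phi -> Lq_norm U p phi <= C%:E * Lq_vec_norm U p (grad phi).
Proof.
move=> p1; have p0 : (0 < p)%R by rewrite (lt_trans _ p1).
have [M M0 UM] := bounded_set_square bU.
have /andP[K0 Koo] := poincare_itv_cst_lty M0 p1.
have Kfin : poincare_itv_cst p M `^ p^-1 \is a fin_num.
  by rewrite fin_num_poweR// ge0_fin_numE.
exists (fine (poincare_itv_cst p M `^ p^-1)); first by rewrite fine_ge0// poweR_ge0.
move=> phi tphi; rewrite fineK//.
have restr f : test_fun U f -> f \_ U = f.
  move=> tf; apply/funext => x; rewrite patchE; case: ifPn => //.
  by rewrite notin_setE => /(test_fun_out tf) ->.
have td := test_fun_partial (0%R : 'I_2) tphi.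
apply: (@le_trans _ _ (poincare_itv_cst p M `^ p^-1 * Lq_norm U p (partial (0%R : 'I_2) phi))).
  rewrite /Lq_norm unlock /= !restr// -poweRM//; last first.
    by apply: integral_ge0 => x _; rewrite lee_fin powR_ge0.
  apply: ge0_le_poweR.
  - by rewrite invr_gt0.
  - by apply: integral_ge0 => x _; rewrite lee_fin powR_ge0.
  apply: (poincare_square M0 p1).
  - by move=> x; exact: test_fun_diff tphi.
  - exact: test_fun_continuous td.
  - by move=> x nx; apply: (test_fun_out tphi) => /UM.
rewrite lee_wpmul2l ?poweR_ge0//; apply: Lq_norm_ae_le => //.
apply: aeW => x _ /=; rewrite (ger0_norm (enorm_ge0 _)).
by have := coef_le_enorm (grad phi x) (0%R : 'I_2); rewrite mxE.
Qed.

(** Both sides are continuous for the W^{1,p} norm, so the inequality passes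
    from test functions to their closure. *)
Lemma poincare_W10 p : (1 < p)%R -> exists2 C : R, (0 <= C)%R &
  forall chi, W10 U p chi -> Lq_norm U p chi <= C%:E * Lq_vec_norm U p (wgrad U chi).
Proof.
move=> p1; have [C C0 hC] := poincare_test p1; exists C => // chi wchi.
have p1' := ltW p1; have p0 : (0 < p)%R by rewrite (lt_trans _ p1).
have [w1 _] := wchi; apply/lee_addgt0Pr => e e0.
(* an error of e / (1 + C) in chi and in its gradient costs e in total *)
have C1 : (0 < 1 + C)%R by rewrite ltr_pwDl.
have [phi [tphi lt1 lt2]] := W10_approx p1' wchi (divr_gt0 e0 C1).
have mphi := test_fun_measurable tphi; have mchi := W1_measurable w1.
have mg i := @grad_measurable phi i tphi; have mw i := @W1_wgrad_measurable _ _ i w1.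
have gE : measurable_fun (U : set borel2) (enorm \o (fun x => grad phi x - wgrad U chi x)%R).
  apply: measurable_enorm => i; apply: Lq_vec_measurable.
  by apply: (Lq_vecB p1' (test_fun_Lq_grad p0 tphi)); case: w1.
have wE : measurable_fun (U : set borel2) (enorm \o wgrad U chi) by exact: measurable_enorm.
apply: (@le_trans _ _ (Lq_norm U p (fun x => phi x - chi x)%R + Lq_norm U p phi)).
  apply: Lq_norm_le_sum => //; first exact: measurable_funB.
  by apply: aeW => x _; rewrite -{1}(subKr (phi x) (chi x)) [leRHS]addrC ler_normB.
have tri : Lq_vec_norm U p (grad phi) <=
    Lq_vec_norm U p (fun x => grad phi x - wgrad U chi x)%R + Lq_vec_norm U p (wgrad U chi).
  apply: Lq_norm_le_sum => //; apply: aeW => x _ /=.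
  rewrite !(ger0_norm (enorm_ge0 _)) -{1}(subrK (wgrad U chi x) (grad phi x)).
  exact: enormD.
apply: (@le_trans _ _ ((e / (1 + C))%:E +
  C%:E * ((e / (1 + C))%:E + Lq_vec_norm U p (wgrad U chi)))).
  apply: leeD; first exact: ltW.
  apply: le_trans (hC _ tphi) _; apply: lee_wpmul2l; first by rewrite lee_fin.
  by apply: le_trans tri _; apply: leeD => //; exact: ltW.
have d0 : 0 <= (e / (1 + C))%:E by rewrite lee_fin divr_ge0 ?ltW.
rewrite ge0_muleDr ?Lq_vec_norm_ge0//.
rewrite addeA addeC; apply: leeD2l; rewrite -EFinM -EFinD lee_fin.
by rewrite -[X in (X + _)%R]mul1r -mulrDl mulrCA divff ?mulr1// gt_eqF.
Qed.

Lemma Lq_vec_Lq q g : (1 <= q)%R -> Lq_vec U q g -> Lq U q (enorm \o g).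
Proof.
move=> q1 /(Lq_vec_enorm mU _ q1)[mg goo]; apply/(LqP mU); split => //.
exact: measurable_enorm.
Qed.

Lemma measurable_dot g h :
  (forall i, measurable_fun (U : set borel2) (fun x => g x i 0%R)) ->
  (forall i, measurable_fun (U : set borel2) (fun x => h x i 0%R)) ->
  measurable_fun (U : set borel2) (fun x => dot (g x) (h x)).
Proof.
move=> mg mh; rewrite (_ : (fun x => _) =
  fun x => (g x 0 0 * h x 0 0 + g x 1 0 * h x 1 0)%R).
  by apply: measurable_funD; exact: measurable_funM.
by apply/funext => x; rewrite dotE.
Qed.

Lemma hoelder_dot q g h : (1 < q)%R -> Lq_vec U q g -> Lq_vec U (conj_exp q) h ->
  leb2.-integrable U (EFin \o (fun x => dot (g x) (h x))) /\
  `|(\int[leb2]_(x in U) dot (g x) (h x))%R|%:E <=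
     Lq_vec_norm U q g * Lq_vec_norm U (conj_exp q) h.
Proof.
move=> q1 Lg Lh; have q'1 := conj_exp_gt1 q1.
apply: (Lq_hoelder_integrable mU q1 (Lq_vec_Lq (ltW q1) Lg) (Lq_vec_Lq (ltW q'1) Lh)).
  by apply: measurable_dot => i; [exact: Lq_vec_measurable Lg|exact: Lq_vec_measurable Lh].
apply: aeW => x _ /=; rewrite (ger0_norm (enorm_ge0 _)) (ger0_norm (enorm_ge0 _)).
exact: dot_le.
Qed.

Lemma hoelder_Lq q f v : (1 < q)%R -> Lq U q f -> Lq U (conj_exp q) v ->
  leb2.-integrable U (EFin \o (fun x => f x * v x)%R) /\
  `|(\int[leb2]_(x in U) (f x * v x))%R|%:E <=
     Lq_norm U q f * Lq_norm U (conj_exp q) v.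
Proof.
move=> q1 Lf Lv; apply: (Lq_hoelder_integrable mU q1 Lf Lv).
  by apply: measurable_funM; [case/(LqP mU): Lf|case/(LqP mU): Lv].
by apply: aeW => x _; rewrite normrM.
Qed.

(** The definition of the weak divergence tests against smooth functions only;
    by Hoelder both sides are continuous in chi for the W^{1,q'} norm, which
    extends the identity to W_0^{1,q'}. *)
Lemma div_duality q tau chi : (1 < q)%R -> Hdiv U q tau -> W10 U (conj_exp q) chi ->
  (\int[leb2]_(x in U) dot (tau x) (wgrad U chi x) =
   - \int[leb2]_(x in U) (wdiv U tau x * chi x))%R.
Proof.
move=> q1 [Ltau exd Ld] wchi; have q'1 := conj_exp_gt1 q1.
have [_ _ divE] : is_weak_div U tau (wdiv U tau).
  have [d hd] := exd.
  exact: (@xgetPex _ (fun=> 0%R) [set d | is_weak_div U tau d] (ex_intro _ d hd)).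
have [w1 _] := wchi; have [Lchi _ Lw] := w1.
have q'1' := ltW q'1; have q'0 : (0 < conj_exp q)%R by rewrite (lt_trans _ q'1).
have [itw _] := hoelder_dot q1 Ltau Lw; have [idc _] := hoelder_Lq q1 Ld Lchi.
set I := (\int[leb2]_(x in U) _)%R; set J := (\int[leb2]_(x in U) _)%R.
have Tfin : Lq_vec_norm U q tau \is a fin_num.
  by rewrite ge0_fin_numE ?Lq_vec_norm_ge0//; case/(Lq_vec_enorm mU _ (ltW q1)): Ltau.
have Dfin : Lq_norm U q (wdiv U tau) \is a fin_num.
  by rewrite ge0_fin_numE ?Lq_norm_ge0//; case/(LqP mU): Ld.
set T := fine (Lq_vec_norm U q tau); set D := fine (Lq_norm U q (wdiv U tau)).
have T0 : (0 <= T)%R by rewrite fine_ge0 ?Lq_vec_norm_ge0.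
have D0 : (0 <= D)%R by rewrite fine_ge0 ?Lq_norm_ge0.
have key (e : R) : (0 < e)%R -> (`|I + J| <= (T + D) * e)%R.
  move=> e0; have [phi [tphi lt1 lt2]] := W10_approx q'1' wchi e0.
  have Lg := test_fun_Lq_grad q'0 tphi; have Lp := test_fun_Lq q'0 tphi.
  have [itg _] := hoelder_dot q1 Ltau Lg; have [idp _] := hoelder_Lq q1 Ld Lp.
  have [_ le1] := hoelder_dot q1 Ltau (Lq_vecB q'1' Lg Lw).
  have LB : Lq U (conj_exp q) (fun x => phi x - chi x)%R.
    have := LqD mU q'1' (LqZ mU (-1) q'0 Lchi) Lp.
    by congr (Lq _ _ _); apply/funext => x; rewrite mulN1r addrC.
  have [_ le2] := hoelder_Lq q1 Ld LB.
  have E1 : (\int[leb2]_(x in U) dot (tau x) (grad phi x - wgrad U chi x) =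
      -1 * I + \int[leb2]_(x in U) dot (tau x) (grad phi x))%R.
    rewrite -Rintegral_lin//; apply: eq_Rintegral => x _.
    by rewrite !dotE !mxE; ring.
  have E2 : (\int[leb2]_(x in U) (wdiv U tau x * (phi x - chi x)) =
      -1 * J + \int[leb2]_(x in U) (wdiv U tau x * phi x))%R.
    by rewrite -Rintegral_lin//; apply: eq_Rintegral => x _; ring.
  (* for the test function phi in place of chi, the sum I + J is zero *)
  have -> : (I + J = - (\int[leb2]_(x in U) dot (tau x) (grad phi x - wgrad U chi x) +
      \int[leb2]_(x in U) (wdiv U tau x * (phi x - chi x))))%R.
    by rewrite E1 E2 (divE _ tphi); ring.
  rewrite normrN (le_trans (ler_normD _ _))// mulrDl lerD//.
  - rewrite -lee_fin (le_trans le1)// EFinM fineK//; apply: lee_wpmul2l.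
      exact: Lq_vec_norm_ge0.
    exact: ltW.
  - rewrite -lee_fin (le_trans le2)// EFinM fineK//; apply: lee_wpmul2l.
      exact: Lq_norm_ge0.
    exact: ltW.
apply/eqP; rewrite -addr_eq0 -normr_le0; apply/ler_addgt0Pr => e e0; rewrite add0r.
have TD : (0 < T + D + 1)%R by rewrite ltr_wpDl ?addr_ge0.
have := key (e / (T + D + 1))%R (divr_gt0 e0 TD); move/le_trans; apply.
rewrite mulrA ler_pdivrMr// mulrC; apply: ler_wpM2l; first exact: ltW.
by rewrite lerDl.
Qed.

End W10.

(** * Square roots of elliptic matrices *)
Section SquareRoot.
Context {R : realType}.
Implicit Types (M B : 'M[R]_2) (xi : 'cV[R]_2).

Lemma mulmx2E m n (M : 'M[R]_(m, 2)) (N : 'M[R]_(2, n)) i j :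
  (M *m N) i j = M i 0 * N 0 j + M i 1 * N 1 j.
Proof. by rewrite mxE sum_ord2. Qed.

Lemma ord2P (P : 'I_2 -> Prop) : P 0 -> P 1 -> forall i, P i.
Proof.
move=> P0 P1 i; case: (eqVneq i 0) => [->//|i0].
by have -> : i = 1 by apply/val_inj; move: i i0 => [[|[|]]].
Qed.

Lemma dot_sym_square B xi : B^T = B -> dot xi (B *m B *m xi) = enorm (B *m xi) ^+ 2.
Proof. by move=> sB; rewrite -dot_enorm /dot trmx_mul sB !mulmxA. Qed.

Variables (alpha beta : R) (M : 'M[R]_2).
Hypothesis a0 : 0 < alpha.
Hypothesis sM : M^T = M.
Hypothesis eM : forall xi, alpha * enorm xi ^+ 2 <= dot xi (M *m xi) <= beta * enorm xi ^+ 2.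

Let M10 : M 1 0 = M 0 1. Proof. by rewrite -[in LHS]sM mxE. Qed.

Lemma elliptic_col (x y : R) : alpha * (x ^+ 2 + y ^+ 2) <=
  x * (M 0 0 * x + M 0 1 * y) + y * (M 0 1 * x + M 1 1 * y).
Proof.
have /andP[+ _] := eM (\col_i (if i == 0 then x else y)).
by rewrite dotE !mulmx2E enorm_sq !mxE /= M10.
Qed.

Lemma elliptic_M00 : 0 < M 0 0.
Proof.
have := elliptic_col 1 0; rewrite !mulr0 !mul0r !addr0 !mulr1 mul1r expr1n expr0n addr0 mulr1.
exact: lt_le_trans.
Qed.

Lemma elliptic_M11 : 0 < M 1 1.
Proof.
have := elliptic_col 0 1; rewrite !mulr0 !mul0r !add0r !mulr1 mul1r expr1n expr0n add0r mulr1.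
exact: lt_le_trans.
Qed.

Lemma elliptic_det : 0 < M 0 0 * M 1 1 - M 0 1 ^+ 2.
Proof.
have m0 := elliptic_M00; rewrite -(pmulr_rgt0 _ m0).
(* ellipticity at the vector (- M 0 1, M 0 0), the second row of the adjugate *)
apply: lt_le_trans (_ : alpha * ((- M 0 1) ^+ 2 + M 0 0 ^+ 2) <= _).
  by rewrite mulr_gt0// ltr_wpDl ?sqr_ge0// exprn_gt0.
apply: le_trans (elliptic_col _ _) _; rewrite le_eqVlt; apply/orP; left; apply/eqP; ring.
Qed.

(** By Cayley-Hamilton, M^2 = (tr M) M - (det M) I, so with s = sqrt (det M)
    one gets (M + s I)^2 = (tr M + 2 s) M; dividing M + s I by
    sqrt (tr M + 2 s) gives the root. *)
Lemma sqrtmx_exists : exists B, [/\ B^T = B, forall xi, 0 <= dot xi (B *m xi) & B *m B = M].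
Proof.
have m0 := elliptic_M00; have m1 := elliptic_M11; have md := elliptic_det.
set s := Num.sqrt (M 0 0 * M 1 1 - M 0 1 ^+ 2).
have s0 : 0 <= s by exact: sqrtr_ge0.
have s2 : s ^+ 2 = M 0 0 * M 1 1 - M 0 1 ^+ 2 by rewrite sqr_sqrtr// ltW.
set t := Num.sqrt (M 0 0 + M 1 1 + 2 * s).
have tp : 0 < M 0 0 + M 1 1 + 2 * s by rewrite ltr_wpDr ?mulr_ge0// addr_gt0.
have t0 : 0 < t by rewrite sqrtr_gt0.
have t2 : t ^+ 2 = M 0 0 + M 1 1 + 2 * s by rewrite sqr_sqrtr// ltW.
have tn : t != 0 by rewrite gt_eqF.
exists (t^-1 *: (M + s%:M)); split.
- by rewrite !linearZ /= linearD /= sM tr_scalar_mx.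
- move=> xi; rewrite -scalemxAl mulmxDl mul_scalar_mx dotE !mxE !sum_ord2 /=.
  have /andP[+ _] := eM xi; rewrite dotE enorm_sq !mulmx2E => h.
  have h0 : 0 <= alpha * (xi 0 0 ^+ 2 + xi 1 0 ^+ 2).
    by rewrite mulr_ge0 ?(ltW a0)// addr_ge0 ?sqr_ge0.
  have ti : 0 <= t^-1 by rewrite invr_ge0 ltW.
  have sx : 0 <= s * (xi 0 0 ^+ 2 + xi 1 0 ^+ 2) by rewrite mulr_ge0// addr_ge0 ?sqr_ge0.
  have := mulr_ge0 ti (addr_ge0 (le_trans h0 h) sx).
  by move/le_trans; apply; rewrite le_eqVlt; apply/orP; left; apply/eqP; ring.
- have E : (M + s%:M) *m (M + s%:M) = t ^+ 2 *: M.
    apply/matrixP => i j; rewrite t2 mulmx2E !mxE.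
    move: i j; apply: ord2P; apply: ord2P; rewrite /= ?M10 ?mulr1n ?mulr0n; ring: s2.
  by rewrite -scalemxAl -scalemxAr E !scalerA -expr2 exprVn mulVf ?scale1r// expf_neq0.
Qed.

(** The root is invertible because M is, by the explicit adjugate of M. *)
Lemma sqrtmxP : [/\ (sqrtmx M)^T = sqrtmx M, sqrtmx M *m sqrtmx M = M
  & sqrtmx M \in unitmx].
Proof.
have [B hB] := sqrtmx_exists.
have [s _ BB] := @xgetPex _ 0 [set B : 'M[R]_2 | [/\ B^T = B,
  forall xi, 0 <= dot xi (B *m xi) & B *m B = M]] (ex_intro _ B hB).
have md := elliptic_det; have mn : M 0 0 * M 1 1 - M 0 1 ^+ 2 != 0 by rewrite gt_eqF.
pose N : 'M[R]_2 := \matrix_(i, j) (if i == j then (if i == 0 then M 1 1 else M 0 0) else - M 0 1).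
have MN : M *m ((M 0 0 * M 1 1 - M 0 1 ^+ 2)^-1 *: N) = 1%:M.
  rewrite -scalemxAr; apply: (scalerI mn); rewrite scalerA divff// scale1r.
  apply/matrixP => i j; rewrite mulmx2E !mxE /=.
  move: i j; apply: ord2P; apply: ord2P; rewrite /= ?M10 ?mulr1n ?mulr0n; ring.
split=> //; move: MN; rewrite -{1}BB -mulmxA.
by move=> /mulmx1_unit[].
Qed.

(** Multiplied by B = M^{1/2}, p becomes tau + M g, and
    |B p|^2 = p . M p lies between alpha |p|^2 and beta |p|^2. *)
Lemma elliptic_flux (tau g p : 'cV[R]_2) :
  p = invmx (sqrtmx M) *m tau + sqrtmx M *m g ->
  Num.sqrt alpha * enorm p <= enorm (tau + M *m g) <= Num.sqrt beta * enorm p.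
Proof.
move=> pE; have [sB BB uB] := sqrtmxP.
have Bp : sqrtmx M *m p = tau + M *m g.
  by rewrite pE mulmxDr !mulmxA mulmxV// mul1mx BB.
have b0 : 0 <= beta.
  have /andP[/le_trans h /h] := eM (\col_i (if i == 0 then 1 else 0)).
  rewrite enorm_sq !mxE /= expr1n expr0n addr0 !mulr1; exact/le_trans/ltW.
have := eM p; rewrite -{1 2}BB dot_sym_square// Bp => /andP[lo up].
apply/andP; split.
  rewrite -ler_sqr ?nnegrE ?mulr_ge0 ?enorm_ge0 ?sqrtr_ge0//.
  by rewrite exprMn sqr_sqrtr// ltW.
rewrite -ler_sqr ?nnegrE ?mulr_ge0 ?enorm_ge0 ?sqrtr_ge0//.
by rewrite exprMn (sqr_sqrtr b0).
Qed.

Lemma elliptic_mul_le (g : 'cV[R]_2) : enorm (M *m g) <= beta * enorm g.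
Proof.
have [sB BB uB] := sqrtmxP.
have b0 : 0 <= beta.
  have /andP[/le_trans h /h] := eM (\col_i (if i == 0 then 1 else 0)).
  rewrite enorm_sq !mxE /= expr1n expr0n addr0 !mulr1; exact/le_trans/ltW.
have nB xi : enorm (sqrtmx M *m xi) <= Num.sqrt beta * enorm xi.
  rewrite -ler_sqr ?nnegrE ?mulr_ge0 ?enorm_ge0 ?sqrtr_ge0//.
  rewrite -dot_sym_square// BB exprMn sqr_sqrtr//.
  by have /andP[] := eM xi.
rewrite -{1}BB -mulmxA (le_trans (nB _))//.
rewrite -{2}(sqr_sqrtr b0) expr2 -mulrA ler_wpM2l ?sqrtr_ge0//.
Qed.

End SquareRoot.

(** * The a priori bound for the weak solution *)
Section WellPosed.
Context {R : realType}.
Notation plane := (R * R)%type.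
Notation leb2 := (@lebesgue_measure R \x @lebesgue_measure R)%E.
Notation borel2 := (measurableTypeR R * measurableTypeR R)%type.
Variable U : set plane.
Hypotheses (oU : open U) (bU : bounded_set U).
Let mU : measurable (U : set borel2) := open_measurable2 oU.
Implicit Types (f v w phi chi : plane -> R) (g h : plane -> 'cV[R]_2) (p q : R).

Lemma enorm0 : enorm (0 : 'cV[R]_2) = 0.
Proof. by rewrite enormE !mxE expr0n addr0 sqrtr0. Qed.

Lemma Lq_vec_norm_eq0 q g : 0 < q -> {ae leb2, forall x, U x -> g x = 0} ->
  Lq_vec_norm U q g = 0%E.
Proof.
move=> q0 g0; rewrite -(Lq_norm0 U q0); apply: Lq_norm_ae_eq => //.
by apply: ae_imply g0 => x g0 Ux /=; rewrite g0// enorm0.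
Qed.

(** The constant sequence phi approximates phi. *)
Lemma test_fun_W10 q phi : 1 < q -> test_fun U phi -> W10 U q phi.
Proof.
move=> q1 tphi; have q0 : 0 < q by rewrite (lt_trans _ q1).
have wphi := is_weak_grad_test oU bU tphi.
have wE := wgrad_ae oU wphi.
have [mg goo] := (Lq_vec_enorm mU _ (ltW q1)).1 (test_fun_Lq_grad oU bU q0 tphi).
split.
- split; [exact: test_fun_Lq|by exists (grad phi)|].
  apply/(Lq_vec_enorm mU _ (ltW q1)); split.
    move=> i; have [_ lg _] := is_weak_grad_wgrad (ex_intro _ _ wphi).
    by case: (lg i).
  rewrite /Lq_vec_norm (@Lq_norm_ae_eq _ _ _ _ (enorm \o grad phi))//.
  by apply: ae_imply wE => x wE Ux /=; rewrite wE.
- move=> eps e0; exists phi => //.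
  have d0 : (phi \- phi)%R = fun x => -1 * phi x + phi x.
    by apply/funext => x; rewrite mulN1r addrC.
  have := is_weak_grad_lin oU (-1) wphi wphi; rewrite -d0 => /(wgrad_ae oU) w0.
  apply: le_lt_trans (W1_norm_le _ _ (ltW q1)) _.
  rewrite (Lq_vec_norm_eq0 q0); last first.
    by apply: ae_imply w0 => x w0 Ux; rewrite w0// scaleN1r addNr.
  rewrite (_ : (phi \- phi)%R = fun=> 0); last by apply/funext => x; rewrite /= subrr.
  by rewrite Lq_norm0// adde0 mule0 lte_fin.
Qed.

(** The dual norm is a supremum over nonzero functions of W_0^{1,q'}, which
    could a priori be empty. In that case every test function is null, so the
    constant 1 is orthogonal to all of them and must vanish almost everywhere
    on U. *)
Lemma W10_trivial_null q : 1 < q -> (forall chi, W10 U q chi -> eq_ae U chi (fun=> 0)) ->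
  {ae leb2, forall x, ~ U x}.
Proof.
move=> q1 triv.
have l1 : loc_integrable U (fun=> 1 : R).
  split=> [|K cK KU]; first exact: measurable_cst.
  have clK : closed K by apply: compact_closed => //; exact: norm_hausdorff.
  have mK : measurable (K : set borel2) by exact: closed_measurable2.
  have [M M0 KM] : exists2 M, 0 < M & K `<=` square M.
    exact/bounded_set_square/compact_bounded.
  apply: measurable_bounded_integrable => //.
  - apply: le_lt_trans (leb2_cbox_lty (- M, - M) (M, M)).
    apply: le_measure; rewrite ?inE//; first exact: measurable_cbox.
    by move=> x /KM /box_sub_cbox.
  - by exists 1; split; [exact: num_real|move=> D D1 x _; rewrite normr1 ltW].
have := fundamental_lemma oU l1; case=> [phi tphi|N hN].
  have tz := triv _ (test_fun_W10 q1 tphi).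
  rewrite (@eq_ae_Rintegral _ U oU _ (fun=> 0)) //.
  - by rewrite Rintegral_cst// mul0r.
  - by apply: measurable_funM => //; exact: test_fun_measurable.
  - by apply: ae_imply tz => x tz Ux; rewrite tz// mulr0.
have : {ae leb2, forall x, U x -> 1 = 0 :> R} by exists N.
by apply: ae_imply => x h /h /eqP; rewrite oner_eq0.
Qed.

Lemma W1_wgrad q v : W1 U q v -> is_weak_grad U v (wgrad U v).
Proof. by move=> [_ ? _]; exact: is_weak_grad_wgrad. Qed.

(** The distribution -div w + d as a functional on W_0^{1,q'}; for
    w = tau + A grad v and d = div tau it is the right-hand side of the equation
    solved by v. *)
Definition functional (w : plane -> 'cV[R]_2) (d : plane -> R) (chi : plane -> R) : R :=
  \int[leb2]_(x in U) dot (w x) (wgrad U chi x) + \int[leb2]_(x in U) (d x * chi x).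

Section Functional.
Variables (q Cp : R) (w : plane -> 'cV[R]_2) (d : plane -> R).
Hypotheses (q1 : 1 < q) (Cp0 : 0 <= Cp).
Hypothesis hCp : forall chi, W10 U (conj_exp q) chi ->
  (Lq_norm U (conj_exp q) chi <= Cp%:E * Lq_vec_norm U (conj_exp q) (wgrad U chi))%E.
Hypotheses (Lw : Lq_vec U q w) (Ld : Lq U q d).

Let q'1 := conj_exp_gt1 q1.
Let q'0 : 0 < conj_exp q := lt_trans ltr01 q'1.

Definition functional_bound : R :=
  fine (Lq_vec_norm U q w) + Cp * fine (Lq_norm U q d).

Lemma functional_bound_ge0 : 0 <= functional_bound.
Proof. by rewrite addr_ge0 ?mulr_ge0 ?fine_ge0 ?Lq_vec_norm_ge0 ?Lq_norm_ge0. Qed.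

(** Hoelder on both integrals, then Poincare for chi itself. *)
Lemma functional_le chi : W10 U (conj_exp q) chi ->
  (`|functional w d chi|%:E <=
    functional_bound%:E * Lq_vec_norm U (conj_exp q) (wgrad U chi))%E.
Proof.
move=> wchi; have [w1 _] := wchi; have [Lchi _ Lg] := w1.
have [_ le1] := hoelder_dot oU q1 Lw Lg; have [_ le2] := hoelder_Lq oU q1 Ld Lchi.
have wfin : Lq_vec_norm U q w \is a fin_num.
  by rewrite ge0_fin_numE ?Lq_vec_norm_ge0//; case/(Lq_vec_enorm mU _ (ltW q1)): Lw.
have dfin : Lq_norm U q d \is a fin_num.
  by rewrite ge0_fin_numE ?Lq_norm_ge0//; case/(LqP mU): Ld.
rewrite /functional_bound EFinD EFinM !fineK//.
rewrite ge0_muleDl ?mule_ge0 ?Lq_vec_norm_ge0 ?Lq_norm_ge0//.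
apply: (@le_trans _ _ (`|\int[leb2]_(x in U) dot (w x) (wgrad U chi x)|%:E
   + `|\int[leb2]_(x in U) (d x * chi x)|%:E)%E).
  by rewrite -EFinD lee_fin ler_normD.
apply: leeD => //; apply: le_trans le2 _.
rewrite (muleC Cp%:E) -muleA; apply: lee_wpmul2l; first exact: Lq_norm_ge0.
exact: hCp.
Qed.

Lemma functional_lin (a : R) chi psi : W10 U (conj_exp q) chi -> W10 U (conj_exp q) psi ->
  functional w d (fun x => a * chi x + psi x) = a * functional w d chi + functional w d psi.
Proof.
move=> [w1 _] [w2 _]; have [Lchi _ Lg] := w1; have [Lpsi _ Lh] := w2.
have [i1 _] := hoelder_dot oU q1 Lw Lg; have [i2 _] := hoelder_Lq oU q1 Ld Lchi.
have [j1 _] := hoelder_dot oU q1 Lw Lh; have [j2 _] := hoelder_Lq oU q1 Ld Lpsi.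
have wl := is_weak_grad_lin oU a (W1_wgrad w1) (W1_wgrad w2).
have [_ lg _] := is_weak_grad_wgrad (ex_intro _ _ wl).
have wE := wgrad_ae oU wl.
rewrite /functional (@eq_ae_Rintegral _ U oU _
  (fun x => a * dot (w x) (wgrad U chi x) + dot (w x) (wgrad U psi x))); last 3 first.
- apply: measurable_dot => // i; first exact: (Lq_vec_measurable oU _ Lw).
  by case: (lg i).
- apply: measurable_funD; first apply: measurable_funM => //.
  + by apply: measurable_dot => // i;
      [exact: (Lq_vec_measurable oU _ Lw)|exact: (Lq_vec_measurable oU _ Lg)].
  + by apply: measurable_dot => // i;
      [exact: (Lq_vec_measurable oU _ Lw)|exact: (Lq_vec_measurable oU _ Lh)].
- by apply: ae_imply wE => x wE Ux; rewrite wE// !dotE !mxE; ring.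
rewrite Rintegral_lin//.
have -> : \int[leb2]_(x in U) (d x * (a * chi x + psi x)) =
    a * \int[leb2]_(x in U) (d x * chi x) + \int[leb2]_(x in U) (d x * psi x).
  by rewrite -Rintegral_lin//; apply: eq_Rintegral => x _; ring.
have regroup (x y z t : R) : a * x + y + (a * z + t) = a * (x + z) + (y + t) by ring.
exact: regroup.
Qed.

Lemma functional_Wm1 : Wm1 U q (functional w d).
Proof.
split; first exact: functional_lin.
exists functional_bound => chi wchi; apply: le_trans (functional_le wchi) _.
apply: lee_wpmul2l; first by rewrite lee_fin functional_bound_ge0.
exact: Lq_wgrad_le_W1_norm.
Qed.

Lemma Wm1_opp F : Wm1 U q F -> Wm1 U q (fun chi => - F chi).
Proof.
move=> [lF [M bF]]; split.
- by move=> a chi psi wc wp; rewrite lF// opprD mulrN.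
- by exists M => chi wc; rewrite normrN; exact: bF.
Qed.

(** The quotient is 0 when the gradient has zero norm, so no case is lost. *)
Lemma functional_quot_le chi : W10 U (conj_exp q) chi ->
  functional w d chi / fine (Lq_vec_norm U (conj_exp q) (wgrad U chi)) <= functional_bound.
Proof.
move=> wchi; have [w1 _] := wchi.
set n := fine _; have n0 : 0 <= n by rewrite fine_ge0// Lq_vec_norm_ge0.
have [->|nn] := eqVneq n 0; first by rewrite invr0 mulr0 functional_bound_ge0.
rewrite ler_pdivrMr; last by rewrite lt_neqAle eq_sym nn.
apply: le_trans (ler_norm _) _; rewrite -lee_fin (le_trans (functional_le wchi))//.
rewrite EFinM fineK//.
by rewrite ge0_fin_numE ?Lq_vec_norm_ge0//; exact: (W1_wgrad_lty oU (ltW q'1) w1).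
Qed.

(** Uniqueness identifies v with the solution for which the a priori estimate
    holds. The constant Creg carries no sign, so for Creg < 0 the estimate has
    to be exploited differently; the maximum with 0 works in all cases. *)
Lemma well_posed_le A Creg v : W1q_well_posed U q A Creg -> W10 U q v ->
  weak_solution U q A (functional w d) v ->
  (Lq_vec_norm U q (wgrad U v) <= (Num.max Creg 0 * functional_bound)%:E)%E.
Proof.
move=> wp wv sv; have q0 : 0 < q by rewrite (lt_trans _ q1).
have K0 : 0 <= Num.max Creg 0 * functional_bound.
  by rewrite mulr_ge0 ?functional_bound_ge0// le_max lexx orbT.
have [z [[wz sz] uniq zle]] := wp _ functional_Wm1.
have vz : eq_ae U v z by exact: uniq.
have -> : Lq_vec_norm U q (wgrad U v) = Lq_vec_norm U q (wgrad U z).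
  apply: Lq_norm_ae_eq => //.
  have [[_ ev _] _] := wv; have [[_ ez _] _] := wz.
  by apply: ae_imply (wgrad_congr oU ev ez vz) => x h Ux; rewrite /= h.
have [[chi [wchi nchi]]|none] := pselect (exists chi, W10 U (conj_exp q) chi /\
    ~ eq_ae U chi (fun=> 0)); last first.
  have Unull : {ae leb2, forall x, ~ U x}.
    apply: (W10_trivial_null q'1) => chi wchi; apply: contrapT => nchi.
    by apply: none; exists chi.
  rewrite Lq_vec_norm_eq0 ?lee_fin//.
  by apply: ae_imply Unull => x nU /nU.
have Nle : (Wm1_norm U q (functional w d) <= functional_bound%:E)%E.
  apply: ge_ereal_sup => _ [psi [wpsi _] <-]; rewrite lee_fin.
  exact: functional_quot_le.
have [C0|C0] := leP 0 Creg.
  apply: le_trans zle _; rewrite EFinM.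
  by apply: lee_wpmul2l; rewrite ?lee_fin.
(* For Creg < 0 the a priori bound makes the dual norms of F and of -F both
   nonpositive; evaluated at one nonzero chi they force the norm of F to be 0. *)
have neg F z' : (Lq_vec_norm U q (wgrad U z') <= Creg%:E * Wm1_norm U q F)%E ->
    (Wm1_norm U q F <= 0)%E.
  move=> le; rewrite leNgt; apply/negP => N0.
  have : (Creg%:E * Wm1_norm U q F < 0)%E by rewrite mule_lt0_gt0 ?lte_fin.
  by rewrite ltNge (le_trans (Lq_vec_norm_ge0 _ _ _) le).
have N0 := neg _ _ zle.
have [z' [_ _ zle']] := wp _ (Wm1_opp functional_Wm1).
have N0' := neg _ _ zle'.
have N1 : (0 <= Wm1_norm U q (functional w d))%E.
  pose n := fine (Lq_vec_norm U (conj_exp q) (wgrad U chi)).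
  have h1 : ((functional w d chi / n)%:E <= Wm1_norm U q (functional w d))%E.
    by apply: ereal_sup_ubound; exists chi.
  have h2 : ((- functional w d chi / n)%:E <= Wm1_norm U q (fun chi => - functional w d chi)%R)%E.
    by apply: ereal_sup_ubound; exists chi.
  apply: le_trans h1; rewrite lee_fin -oppr_le0 -mulNr -lee_fin.
  exact: le_trans h2 N0'.
have NE : Wm1_norm U q (functional w d) = 0%E by apply/eqP; rewrite eq_le N0 N1.
by apply: le_trans zle _; rewrite NE mule0 lee_fin mul0r.
Qed.

End Functional.

End WellPosed.

(** * Equivalence of the two norms *)
Section NormEquiv.
Context {R : realType}.

(** What is left once all norms are known to be finite. Here t, d, p, w, n, V
    and Nv stand for the norms of tau, div tau, A^{-1/2} tau + A^{1/2} grad v,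
    tau + A grad v, grad v, v in W^{1,q} and v in L^q; sa and sb are the square
    roots of alpha and beta, K bounds Creg, and P1, P2 are Poincare constants
    for the exponents q and q'. *)
Lemma norm_equiv_arith (sa sb beta K P1 P2 t d p w n V Nv : R) :
  0 < sa -> 0 < sb -> 0 <= beta -> 0 <= K -> 0 <= P1 -> 0 <= P2 ->
  0 <= t -> 0 <= d -> 0 <= p -> 0 <= n -> 0 <= V ->
  w <= sb * p -> sa * p <= w -> w <= t + beta * n -> t <= w + beta * n ->
  n <= V -> V <= 2 * (Nv + n) -> Nv <= P1 * n -> n <= K * (w + P2 * d) ->
  let L := beta + 2 * (P1 + 1) in
  (sa^-1 * (1 + beta) + 1)^-1 * (p + d) <= t + V + d /\
  t + V + d <= ((1 + L * K) * sb + L * K * P2 + 1) * (p + d).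
Proof.
move=> sa0 sb0 b0 K0 P10 P20 t0 d0 p0 n0 V0 wp pw wt tw nV VN NP nK L.
have L0 : 0 <= L by rewrite addr_ge0// mulr_ge0// addr_ge0.
have si0 : 0 < sa^-1 by rewrite invr_gt0.
split.
  rewrite ler_pdivrMl; last by rewrite ltr_wpDl// mulr_ge0 ?(ltW si0)// addr_ge0.
  have h1 : p <= sa^-1 * w by rewrite ler_pdivlMl.
  have h2 : sa^-1 * w <= sa^-1 * ((1 + beta) * (t + V + d)).
    apply: ler_wpM2l; first exact: ltW.
    apply: le_trans wt _; have : beta * n <= beta * V by apply: ler_wpM2l.
    have := mulr_ge0 b0 t0; have := mulr_ge0 b0 d0; nra.
  by rewrite mulrDl mul1r -mulrA lerD//; [exact: le_trans h1 h2|rewrite lerDr addr_ge0].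
have h1 : t + V <= w + L * n.
  have : V <= 2 * (P1 + 1) * n by nra.
  rewrite /L mulrDl; lra.
have h2 : L * n <= L * (K * (w + P2 * d)) by apply: ler_wpM2l.
have LK0 : 0 <= L * K by exact: mulr_ge0.
have h3 : (1 + L * K) * w <= (1 + L * K) * (sb * p).
  by apply: ler_wpM2l => //; rewrite addr_ge0.
have h4 : 0 <= (1 + L * K) * (sb * d) by rewrite mulr_ge0 ?addr_ge0// mulr_ge0// ltW.
have h5 : 0 <= L * K * P2 * p by rewrite !mulr_ge0.
have -> : ((1 + L * K) * sb + L * K * P2 + 1) * (p + d) =
  (1 + L * K) * (sb * p) + (1 + L * K) * (sb * d) + L * K * P2 * p + L * K * P2 * d + p + d by ring.
have h6 : w + L * (K * (w + P2 * d)) = (1 + L * K) * w + L * K * P2 * d by ring.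
lra.
Qed.

End NormEquiv.

Theorem theorem7p3 (R : realType) (Omega : set (R * R))
    (hLip : lipschitz_domain Omega) (hsc : simply_connected Omega)
    (alpha beta q Creg : R)
    (halpha : 0 < alpha) (halphabeta : alpha <= beta) (hq : 1 < q) :
  exists c C : R, 0 < c /\ 0 < C /\
  forall A : R * R -> 'M[R]_2,
    Linfty_mx Omega A -> symmetric_ae Omega A -> elliptic Omega alpha beta A ->
    W1q_well_posed Omega q A Creg ->
  forall (tau : R * R -> 'cV[R]_2) (v : R * R -> R),
    Hdiv Omega q tau -> W10 Omega q v ->
    let lhs :=
      (Lq_vec_norm Omega q tau + W1_norm Omega q v
       + Lq_norm Omega q (wdiv Omega tau))%E in
    let rhs :=
      (Lq_vec_norm Omega q
         (fun x => (invmx (sqrtmx (A x)) *m tau x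
                   + sqrtmx (A x) *m wgrad Omega v x)%R)
       + Lq_norm Omega q (wdiv Omega tau))%E in
    (c%:E * rhs <= lhs)%E /\ (lhs <= C%:E * rhs)%E.
Proof.
have [_ oU _ bU _] := hLip.
have mU := open_measurable2 oU.
have q0 : 0 < q by rewrite (lt_trans _ hq).
have q1 := ltW hq.
have [P1 P10 hP1] := poincare_W10 oU bU hq.
have [P2 P20 hP2] := poincare_W10 oU bU (conj_exp_gt1 hq).
have beta0 : 0 < beta by exact: lt_le_trans halphabeta.
set sa := Num.sqrt alpha; set sb := Num.sqrt beta.
have sa0 : 0 < sa by rewrite sqrtr_gt0.
have sb0 : 0 < sb by rewrite sqrtr_gt0.
set K := Num.max Creg 0.
have K0 : 0 <= K by rewrite le_max lexx orbT.
pose L := beta + 2 * (P1 + 1).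
have L0 : 0 <= L by rewrite addr_ge0 ?(ltW beta0)// mulr_ge0// addr_ge0.
have LK0 : 0 <= L * K by exact: mulr_ge0.
exists (sa^-1 * (1 + beta) + 1)^-1, ((1 + L * K) * sb + L * K * P2 + 1).
split.
  by rewrite invr_gt0 ltr_wpDl// mulr_ge0 ?invr_ge0 ?(ltW sa0)// addr_ge0// ltW.
split.
  apply: ltr_wpDl => //; apply: addr_ge0; last exact: mulr_ge0.
  by apply: mulr_ge0; [exact: addr_ge0|exact: ltW].
move=> A LA sA eA wpA tau v Htau Wv; cbv zeta.
have [Ltau _ Ld] := Htau; have [w1 _] := Wv; have [Lv _ Lg] := w1.
set d := wdiv Omega tau in Ld *; set g := wgrad Omega v in Lg *.
pose w x := tau x + A x *m g x.
set pf := fun x => _.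
have good : {ae (@lebesgue_measure R \x @lebesgue_measure R)%E, forall x, Omega x ->
    [/\ sa * enorm (pf x) <= enorm (w x), enorm (w x) <= sb * enorm (pf x)
      & enorm (A x *m g x) <= beta * enorm (g x)]}.
  apply: ae_imply2 sA eA => x sAx eAx Ux.
  have /andP[? ?] := elliptic_flux halpha (sAx Ux) (eAx Ux) (erefl (pf x)).
  split => //; exact: (elliptic_mul_le halpha (sAx Ux) (eAx Ux)).
have mtau i := Lq_vec_measurable oU i Ltau.
have mg i := Lq_vec_measurable oU i Lg.
have mA i j : measurable_fun (Omega : set (measurableTypeR R * measurableTypeR R))
    (fun x => A x i j).
  by apply/(restrict_measurable mU); exact: (set_mem (sub_Lfun_mfun (LA i j))).
have mw i : measurable_fun (Omega : set (measurableTypeR R * measurableTypeR R))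
    (fun x => w x i 0).
  rewrite (_ : (fun x => _) =
    fun x => tau x i 0 + (A x i 0 * g x 0 0 + A x i 1 * g x 1 0)); last first.
    by apply/funext => x; rewrite mxE mulmx2E.
  by apply: measurable_funD => //; apply: measurable_funD; exact: measurable_funM.
have met := measurable_enorm mtau; have meg := measurable_enorm mg.
have mew := measurable_enorm mw.
have mbg : measurable_fun (Omega : set (measurableTypeR R * measurableTypeR R))
  (fun x => beta * (enorm \o g) x) by exact: measurable_funM.
have [_ toom] := (Lq_vec_enorm mU _ q1).1 Ltau.
have [_ goom] := (Lq_vec_enorm mU _ q1).1 Lg.
have [_ doom] := (LqP mU _ _).1 Ld.
have w_le : (Lq_vec_norm Omega q w <=
    Lq_vec_norm Omega q tau + beta%:E * Lq_vec_norm Omega q g)%E.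
  rewrite -[X in X%:E](ger0_norm (ltW beta0)) -(Lq_normZ mU beta q0 meg).
  apply: Lq_norm_le_sum => //; apply: ae_imply good => x good Ux /=.
  have [_ _ le] := good Ux.
  rewrite !(ger0_norm (enorm_ge0 _)) ger0_norm ?mulr_ge0 ?enorm_ge0 ?(ltW beta0)//.
  exact: le_trans (enormD _ _) (lerD _ le).
have tau_le : (Lq_vec_norm Omega q tau <=
    Lq_vec_norm Omega q w + beta%:E * Lq_vec_norm Omega q g)%E.
  rewrite -[X in X%:E](ger0_norm (ltW beta0)) -(Lq_normZ mU beta q0 meg).
  apply: Lq_norm_le_sum => //; apply: ae_imply good => x good Ux /=.
  have [_ _ le] := good Ux.
  rewrite !(ger0_norm (enorm_ge0 _)) ger0_norm ?mulr_ge0 ?enorm_ge0 ?(ltW beta0)//.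
  have -> : tau x = w x + (-1) *: (A x *m g x) by rewrite scaleN1r addrK.
  apply: le_trans (enormD _ _) (lerD _ _) => //.
  by rewrite enormZ normrN1 mul1r.
have p_le : (sa%:E * Lq_vec_norm Omega q pf <= Lq_vec_norm Omega q w)%E.
  rewrite muleC -lee_pdivlMr// muleC -{1}(@ger0_norm _ sa^-1) ?invr_ge0 ?(ltW sa0)//.
  rewrite -(Lq_normZ mU _ q0 mew); apply: Lq_norm_ae_le => //.
  apply: ae_imply good => x good Ux /=; have [le _ _] := good Ux.
  rewrite !ger0_norm ?mulr_ge0 ?enorm_ge0 ?invr_ge0 ?(ltW sa0)//.
  by rewrite ler_pdivlMl.
have w_le_p : (Lq_vec_norm Omega q w <= sb%:E * Lq_vec_norm Omega q pf)%E.
  rewrite -lee_pdivrMl// -{1}(@ger0_norm _ sb^-1) ?invr_ge0 ?(ltW sb0)//.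
  rewrite -(Lq_normZ mU _ q0 mew); apply: Lq_norm_ae_le => //.
  apply: ae_imply good => x good Ux /=; have [_ le _] := good Ux.
  rewrite !ger0_norm ?mulr_ge0 ?enorm_ge0 ?invr_ge0 ?(ltW sb0)//.
  by rewrite ler_pdivrMl.
have fin_of (x : \bar R) : (0 <= x -> x < +oo -> x \is a fin_num)%E.
  by move=> x0 xoo; rewrite ge0_fin_numE.
have tfin := fin_of _ (Lq_vec_norm_ge0 _ _ _) toom.
have gfin := fin_of _ (Lq_vec_norm_ge0 _ _ _) goom.
have dfin := fin_of _ (Lq_norm_ge0 _ _ _) doom.
have woom : (Lq_vec_norm Omega q w < +oo)%E.
  apply: le_lt_trans w_le _; rewrite lte_add_pinfty// lte_mul_pinfty ?lee_fin ?(ltW beta0)//.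
have wfin := fin_of _ (Lq_vec_norm_ge0 _ _ _) woom.
have Lw : Lq_vec Omega q w by apply/(Lq_vec_enorm mU _ q1).
have pfin : Lq_vec_norm Omega q pf \is a fin_num.
  apply: fin_of; first exact: Lq_vec_norm_ge0.
  have : (sa%:E * Lq_vec_norm Omega q pf < +oo)%E by exact: le_lt_trans p_le woom.
  rewrite !ltey; apply: contra => /eqP ->; by rewrite gt0_muley ?lte_fin.
have nvfin : Lq_norm Omega q v \is a fin_num.
  by apply: fin_of; [exact: Lq_norm_ge0|exact: (W1_Lq_lty oU w1)].
have V_le := W1_norm_le Omega v q1.
have g_le_V := Lq_wgrad_le_W1_norm Omega v q0.
have Vfin : W1_norm Omega q v \is a fin_num.
  apply: fin_of; first by apply: le_trans g_le_V; exact: Lq_vec_norm_ge0.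
  apply: le_lt_trans V_le _; rewrite -/g -(fineK nvfin) -(fineK gfin) -EFinD -EFinM.
  exact: ltry.
have sol : weak_solution Omega q A (functional Omega w d) v.
  move=> chi Wchi; have [[Lchi _ Lh] _] := Wchi.
  have LAg : Lq_vec Omega q (fun x => A x *m g x).
    have := Lq_vecB oU q1 Lw Ltau; congr (Lq_vec _ _ _).
    by apply/funext => x; rewrite /w addrC addKr.
  have [i1 _] := hoelder_dot oU hq Ltau Lh; have [i2 _] := hoelder_dot oU hq LAg Lh.
  rewrite /functional.
  have -> : Rintegral (@lebesgue_measure R \x @lebesgue_measure R)%E Omega
      (fun x => dot (w x) (wgrad Omega chi x)) =
    1 * Rintegral (@lebesgue_measure R \x @lebesgue_measure R)%E Omega
      (fun x => dot (tau x) (wgrad Omega chi x)) +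
    Rintegral (@lebesgue_measure R \x @lebesgue_measure R)%E Omega
      (fun x => dot (A x *m g x) (wgrad Omega chi x)).
    rewrite -(Rintegral_lin oU)//; apply: eq_Rintegral => x _.
    by rewrite !dotE /w !mxE; ring.
  rewrite (div_duality oU bU hq Htau Wchi) mul1r.
  by rewrite addrC addrA subrr add0r.
have g_le := well_posed_le oU bU hq P20 hP2 Lw Ld wpA Wv sol.
have nv_le := hP1 _ Wv.
rewrite -/g in V_le g_le_V g_le nv_le.
rewrite /functional_bound in g_le.
move: w_le tau_le p_le w_le_p V_le g_le_V g_le nv_le.
rewrite -(fineK tfin) -(fineK gfin) -(fineK dfin) -(fineK wfin) -(fineK pfin).
rewrite -(fineK nvfin) -(fineK Vfin) /= -!EFinM -!EFinD -?EFinM !lee_fin.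
move=> w_le tau_le p_le w_le_p V_le g_le_V g_le nv_le.
apply: (norm_equiv_arith sa0 sb0 (ltW beta0) K0 P10 P20 _ _ _ _ _ w_le_p p_le w_le
  tau_le g_le_V V_le nv_le g_le);
  by rewrite fine_ge0 ?Lq_norm_ge0 ?Lq_vec_norm_ge0 ?poweR_ge0.
Qed.
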